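(* Let $V\subseteq B(\mathcal H)$ be an operator space. Then $$\mathcal F(V)=\{T\in B(\mathcal H): E(T)=T \text{ for every } E\in\mathcal E(V)\}=\bigcap \mathcal S,$$ where the intersection is taken over all copies $\mathcal S\subseteq B(\mathcal H)$ of $I(V)$. Consequently, $I(V)=I(\mathcal F(V))$.
   Context: A $V$-map is a completely contractive map $\phi:B(\mathcal H)\to B(\mathcal H)$ with $\phi(v)=v$ for all $v\in V$. The fixed space is $\mathcal F(V)=\{T\in B(\mathcal H):\phi(T)=T\text{ for every }V\text{-map }\phi:B(\mathcal H)\to B(\mathcal H)\}$. A minimal $V$-projection is a $V$-map $E$ whose seminorm $p_E(x)=\|E(x)\|$ is minimal (pointwise order) among the seminorms $p_\phi$, $\phi$ a $V$-map; such $E$ is automatically idempotent. $\mathcal E(V)$ is the set of minimal $V$-projections on $B(\mathcal H)$. A copy of $I(V)$ is the range $\mathcal R(E)$ of some $E\in\mathcal E(V)$; each is an injective operator space completely isometrically isomorphic, via a map fixing $V$, to the injective envelope $I(V)$ of $V$. *)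

(* Defs.v *)
From HB Require Import structures.
From mathcomp Require Import all_boot all_order all_algebra.
From mathcomp Require Import sesquilinear complex.
From mathcomp Require Import all_classical all_reals all_analysis.

Set Implicit Arguments.
Unset Strict Implicit.
Unset Printing Implicit Defensive.

Import Order.TTheory GRing.Theory Num.Theory.
Import numFieldNormedType.Exports.

Local Open Scope classical_set_scope.
Local Open Scope ring_scope.
Local Open Scope complex_scope.

(* The inner product is linear in its first argument and conjugate-linear in
   the second. *)
HB.mixin Record CompleteNormedModule_isHilbert (R : realType) H
    of CompleteNormedModule R[i] H := {
  inner : {dot H for (@conjc R)};
  sqr_norm_inner : forall x : H, `|x| ^+ 2 = inner x x
}.

#[short(type="hilbertType")]
HB.structure Definition Hilbert (R : realType) :=
  {H of CompleteNormedModule_isHilbert R H & CompleteNormedModule R[i] H}.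

Section BoundedOperators.
Context {R : realType} {H : hilbertType R}.

Definition is_bounded_operator (T : H -> H) : Prop :=
  linear T /\ exists M : R, forall x, `|T x| <= M%:C * `|x|.

Definition bounded_operator : {pred H -> H} :=
  fun T => `[< is_bounded_operator T >].

Lemma bounded_operator_submod : submod_closed bounded_operator.
Proof.
split.
  apply/asboolP; split; first by move=> a x y /=; rewrite scaler0 addr0.
  by exists 0 => x; rewrite mul0r normr0.
move=> a S T /asboolP[linS [M SM]] /asboolP[linT [N TN]]; apply/asboolP; split.
  move=> b x y /=; rewrite !fctE linS linT !scalerDr !scalerA [b * a]mulrC.
  by rewrite addrACA.
exists (complex.Re `|a| * M + N) => x.
have aE : `|a| = (complex.Re `|a|)%:C by rewrite RRe_real ?normr_real.
have -> : (complex.Re `|a| * M + N)%:C = `|a| * M%:C + N%:C.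
  by rewrite [in RHS]aE -rmorphM -rmorphD.
rewrite mulrDl -mulrA !fctE.
by rewrite (le_trans (ler_normD _ _))// lerD// normrZ ler_wpM2l.
Qed.

HB.instance Definition _ :=
  GRing.isSubmodClosed.Build R[i] (H -> H) bounded_operator
    bounded_operator_submod.

End BoundedOperators.

Record BH (R : realType) (H : hilbertType R) := MkBH {
  BH_fun :> H -> H;
  BH_bounded : BH_fun \in bounded_operator
}.

HB.instance Definition _ (R : realType) (H : hilbertType R) :=
  [isSub for @BH_fun R H].
HB.instance Definition _ (R : realType) (H : hilbertType R) :=
  [Choice of BH H by <:].
HB.instance Definition _ (R : realType) (H : hilbertType R) :=
  [SubChoice_isSubLmodule of BH H by <:].

Section Norms.
Context {R : realType} {H : hilbertType R}.

(* The library norm of H takes its (real) values in R[i]. *)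
Definition rnorm (x : H) : R := complex.Re `|x|.

Definition opnorm (T : BH H) : R :=
  sup [set rnorm (T x) | x in [set x : H | rnorm x <= 1]].

Definition l2norm n (x : 'I_n -> H) : R := Num.sqrt (\sum_i rnorm (x i) ^+ 2).

(* The norm of M_n(B(H)), where A acts on the n-fold Hilbert sum of H by
   (A x)_i = \sum_j A_ij x_j. *)
Definition mxopnorm n (A : 'M[BH H]_n) : R :=
  sup [set l2norm (fun i => \sum_j A i j (x j))
      | x in [set x : 'I_n -> H | l2norm x <= 1]].

End Norms.

(* Operator spaces are linear subspaces of some B(H), not assumed to be
   norm-closed. *)
Definition operator_space (R : realType) (H : hilbertType R)
    (V : set (BH H)) : Prop :=
  V 0 /\ forall (a : R[i]) x y, V x -> V y -> V (a *: x + y).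

(* A map between operator spaces W and Y is encoded by a function defined on
   the whole of B(H), of which only the values on W are meaningful. *)
Section Maps.
Context {R : realType} {H K : hilbertType R}.
Implicit Types (W : set (BH H)) (Y : set (BH K)) (f : BH H -> BH K).

Definition linear_on W f : Prop :=
  forall (a : R[i]) x y, W x -> W y -> f (a *: x + y) = a *: f x + f y.

Definition matrices_over W n (A : 'M[BH H]_n) : Prop := forall i j, W (A i j).

Definition completely_contractive W Y f : Prop :=
  [/\ linear_on W f, (forall x, W x -> Y (f x)) &
      forall n (A : 'M[BH H]_n), matrices_over W A ->
        mxopnorm (map_mx f A) <= mxopnorm A].

Definition completely_isometric W Y f : Prop :=
  [/\ linear_on W f, (forall x, W x -> Y (f x)) &
      forall n (A : 'M[BH H]_n), matrices_over W A ->
        mxopnorm (map_mx f A) = mxopnorm A].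

End Maps.

Definition injective_space (R : realType) (K : hilbertType R)
    (Y : set (BH K)) : Prop :=
  operator_space Y /\
  forall (L : hilbertType R) (W Z : set (BH L)),
    operator_space W -> operator_space Z -> W `<=` Z ->
    forall f, completely_contractive W Y f ->
      exists2 g, completely_contractive Z Y g & {in W, g =1 f}.

Definition injective_envelope (R : realType) (H K : hilbertType R)
    (V : set (BH H)) (Y : set (BH K)) (j : BH H -> BH K) : Prop :=
  [/\ injective_space Y, completely_isometric V Y j &
      forall Z, injective_space Z -> j @` V `<=` Z -> Z `<=` Y -> Z = Y].

Section FixedSpace.
Context {R : realType} {H : hilbertType R}.
Implicit Types (V S : set (BH H)) (E phi : BH H -> BH H).

Definition V_map V phi : Prop :=
  completely_contractive setT setT phi /\ {in V, phi =1 id}.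

Definition fixed_space V : set (BH H) :=
  [set T | forall phi, V_map V phi -> phi T = T].

Definition V_seminorm phi (x : BH H) : R := opnorm (phi x).

Definition minimal_V_projection V E : Prop :=
  V_map V E /\
  forall phi, V_map V phi -> (forall x, V_seminorm phi x <= V_seminorm E x) ->
    V_seminorm phi = V_seminorm E.

Definition envelope_copy V S : Prop :=
  exists2 E, minimal_V_projection V E & S = range E.

(* I(V) = I(W) for V `<=` W, as an identity of extensions: the copies
   of I(V) and of I(W) in B(H) coincide, and an operator space Y is an injective
   envelope of V if and only if it is one of W, the embedding of V in Y being
   the restriction of that of W. *)
Definition same_injective_envelope V (W : set (BH H)) : Prop :=
  [/\ forall S, envelope_copy V S <-> envelope_copy W S,
      forall (K : hilbertType R) (Y : set (BH K)) j,
        injective_envelope V Y j ->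
        exists2 k, injective_envelope W Y k & {in V, k =1 j} &
      forall (K : hilbertType R) (Y : set (BH K)) k,
        injective_envelope W Y k -> injective_envelope V Y k].

End FixedSpace.

(* Main.v *)
Require Import Defs.
From HB Require Import structures.
From mathcomp Require Import all_boot all_order all_algebra.
From mathcomp Require Import sesquilinear spectral complex.
From mathcomp Require Import all_classical all_reals all_analysis.
From mathcomp Require Import ring lra.

(** Write p_phi for the seminorm x |-> ||phi x||.  The formal part of the
    argument is short.  If E is a minimal V-projection and phi is a V-map, then
    p_(phi o E) <= p_E, so phi o E is minimal again; an operator fixed by all
    minimal projections is then fixed by phi o E and by E, hence by phi.  A
    minimal E is idempotent: the averages of E, ..., E^n are V-maps below E,
    hence have the seminorm of E, and on T - E T they are of size O(1/n).  So
    the range of E is its set of fixed points, which identifies the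
    intersection of the copies of I(V) with the fixed space
    ([fixed_by_minimal], [minimal_idempotent]).  As V and its fixed space have
    the same V-maps, they have the same copies of their envelopes.

    For an arbitrary envelope Y of V, with embedding j, the injectivity of Y
    extends j to k : B(H) -> Y, and the injectivity of B(H) extends the inverse
    of j to psi : B(K) -> B(H).  Since psi o k is a V-map, it is the identity on
    the fixed space, so k is completely isometric there.  The converse
    ([envelope_from_fixed_space]) rests on rigidity: a complete contraction of
    an injective envelope into itself that fixes the embedded space is the
    identity ([rigidity]).

    Two analytic facts carry this: minimal V-projections exist
    ([minimal_exists]), and complete contractions into B(H) extend
    ([wittstock_extension]).  Both are proved by the same device.  A linear map
    g : B(L) -> B(H) is determined by the functional with value <g T x, y> at
    the tensor y^* (x) T (x) x; and g is completely contractive exactly when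
    the real part of the functional is bounded by the Haagerup norm, the
    infimum of ||y|| ||w|| ||x|| over the factorizations y^* w x of a tensor,
    with w a square matrix over B(L) and x, y tuples of vectors.  With w
    contractive, that product may be replaced by (||x||^2 + ||y||^2) / 2, which
    is additive under direct sums ([cost]).  The Hahn-Banach theorem, stated for
    a cone of pairs (tensor, upper bound), and the Riesz representation theorem
    then produce g from any consistent family of upper bounds that contains
    these ([map_of_cone]).

    For the extension theorem the bounds are the costs together with the values
    of f on tensors over W; they are consistent because the Haagerup norm of a
    tensor over W may be computed over W.  Indeed, diagonalizing the Gram
    matrices of x and y by unitaries makes both tuples orthogonal without
    changing the cost, after which the tensor determines the entries of w
    ([orthogonal_factorization], [factorization_injectivity]).  For the
    existence of minimal projections, Zorn's lemma asks for a lower bound of a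
    chain of V-maps; here the bounds of a tensor are those that its values
    eventually satisfy along the chain, so the Hahn-Banach theorem takes the
    place of a compactness argument. *)

Set Implicit Arguments.
Unset Strict Implicit.
Unset Printing Implicit Defensive.

Import Order.TTheory GRing.Theory Num.Theory.
Import numFieldNormedType.Exports.

Local Open Scope classical_set_scope.
Local Open Scope ring_scope.
Local Open Scope complex_scope.
Local Open Scope sesquilinear_scope.

Local Notation Re := complex.Re.

(** * Inner products *)
Section InnerProduct.
Context {R : realType} {H : hilbertType R}.
Implicit Types (x y z : H) (a : R[i]) (t : R).

Definition sqn x : R := rnorm x ^+ 2.

Lemma rnormE x : `|x| = (rnorm x)%:C.
Proof. by rewrite /rnorm RRe_real // normr_real. Qed.

Lemma rnorm_ge0 x : 0 <= rnorm x.
Proof. by rewrite -ler0c -rnormE. Qed.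

Lemma sqn_ge0 x : 0 <= sqn x. Proof. exact: sqr_ge0. Qed.

Lemma innerxx x : inner x x = (sqn x)%:C.
Proof. by rewrite -sqr_norm_inner rnormE -rmorphXn. Qed.

Lemma sqn_eq0 x : sqn x = 0 -> x = 0.
Proof.
move=> /eqP; rewrite sqrf_eq0 => /eqP rx; apply/normr0_eq0.
by rewrite rnormE rx.
Qed.

Lemma sqn0 : sqn (0 : H) = 0.
Proof. by rewrite /sqn /rnorm normr0 expr0n. Qed.

Lemma innerC x y : inner x y = (inner y x)^*%R.
Proof. by rewrite hermC expr0 mul1r. Qed.

Lemma innerDl x y z : inner (x + y) z = inner x z + inner y z.
Proof. exact: linearDl. Qed.
Lemma innerDr x y z : inner z (x + y) = inner z x + inner z y.
Proof. exact: linearDr. Qed.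
Lemma innerZl a x y : inner (a *: x) y = a * inner x y.
Proof. exact: linearZl_LR. Qed.
Lemma innerZr a x y : inner x (a *: y) = a^* * inner x y.
Proof. exact: linearZr_LR. Qed.
Lemma inner0r x : inner x 0 = 0. Proof. exact: linear0r. Qed.
Lemma innerNl x y : inner (- x) y = - inner x y. Proof. exact: linearNl. Qed.
Lemma innerNr x y : inner y (- x) = - inner y x. Proof. exact: linearNr. Qed.
Lemma inner_suml (I : finType) (F : I -> H) y :
  inner (\sum_i F i) y = \sum_i inner (F i) y.
Proof. exact: linear_sumlz. Qed.
Lemma inner_sumr (I : finType) (F : I -> H) y :
  inner y (\sum_i F i) = \sum_i inner y (F i).
Proof. exact: linear_sumr. Qed.

Lemma sqnE x : sqn x = Re (inner x x). Proof. by rewrite innerxx. Qed.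

Lemma sqnD x y : sqn (x + y) = sqn x + sqn y + 2 * Re (inner x y).
Proof.
rewrite !sqnE innerDl !innerDr (innerC y x) !raddfD /=.
by case: (inner x y) => a b /=; ring.
Qed.

Lemma sqnN x : sqn (- x) = sqn x.
Proof. by rewrite !sqnE innerNl innerNr opprK. Qed.

Lemma sqnZ a x : sqn (a *: x) = Re (a * a^*) * sqn x.
Proof.
rewrite !sqnE innerZl innerZr innerxx; case: a => u v /=; ring.
Qed.

Lemma sqnZr t x : sqn (t%:C *: x) = t ^+ 2 * sqn x.
Proof. by rewrite sqnZ /=; ring. Qed.

Lemma Re_realM t a : Re (t%:C * a) = t * Re a.
Proof. by case: a => u v /=; ring. Qed.

(** Replaces the Cauchy-Schwarz inequality throughout: since tensors may be
    rescaled freely, this additive bound is as strong as the product one. *)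
Lemma Re_inner_le x y : 2 * Re (inner x y) <= sqn x + sqn y.
Proof.
have := sqn_ge0 (x - y); rewrite sqnD sqnN innerNr raddfN /=; lra.
Qed.

End InnerProduct.

(** * Tuples of vectors and contractive matrices of operators *)
Section Tuples.
Context {R : realType} {H : hilbertType R}.

Definition sqn_tuple n (x : 'I_n -> H) : R := \sum_i sqn (x i).

Definition mxapp n (A : 'M[BH H]_n) (x : 'I_n -> H) : 'I_n -> H :=
  fun i => \sum_j A i j (x j).

Definition contractive_mx n (A : 'M[BH H]_n) : Prop :=
  forall x, sqn_tuple (mxapp A x) <= sqn_tuple x.

Lemma sqn_tuple_ge0 n (x : 'I_n -> H) : 0 <= sqn_tuple x.
Proof. by apply: sumr_ge0 => i _; exact: sqn_ge0. Qed.

Lemma sqn_le_tuple n (x : 'I_n -> H) i : sqn (x i) <= sqn_tuple x.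
Proof.
rewrite /sqn_tuple (bigD1 i) //= lerDl.
by apply: sumr_ge0 => j _; exact: sqn_ge0.
Qed.

Lemma sqn_tupleZ n (x : 'I_n -> H) (t : R) :
  sqn_tuple (fun i => t%:C *: x i) = t ^+ 2 * sqn_tuple x.
Proof. by rewrite /sqn_tuple mulr_sumr; apply: eq_bigr => i _; rewrite sqnZr. Qed.

Lemma l2normE n (x : 'I_n -> H) : l2norm x = Num.sqrt (sqn_tuple x).
Proof. by []. Qed.

Lemma sqr_l2norm n (x : 'I_n -> H) : l2norm x ^+ 2 = sqn_tuple x.
Proof. by rewrite l2normE sqr_sqrtr// sqn_tuple_ge0. Qed.

Lemma BHP (T : BH H) : is_bounded_operator T.
Proof. by apply/asboolP; exact: (BH_bounded T). Qed.

Lemma BH_lin (T : BH H) (a : R[i]) x y : T (a *: x + y) = a *: T x + T y.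
Proof. by case: (BHP T) => /(_ a x y). Qed.

Lemma BH0 (T : BH H) : T 0 = 0.
Proof. by have := BH_lin T (-1) 0 0; rewrite scaler0 addr0 scaleN1r addNr. Qed.

Lemma BHZ (T : BH H) (a : R[i]) x : T (a *: x) = a *: T x.
Proof. by rewrite -[a *: x]addr0 BH_lin BH0 addr0. Qed.

Lemma BHD (T : BH H) x y : T (x + y) = T x + T y.
Proof. by rewrite -[x]scale1r BH_lin !scale1r. Qed.

Lemma BH_sum (T : BH H) (I : finType) (F : I -> H) :
  T (\sum_i F i) = \sum_i T (F i).
Proof. by apply: (big_morph T (BHD T) (BH0 T)). Qed.

Lemma BH_ext (S T : BH H) : S =1 T -> S = T.
Proof. by move=> ST; apply: val_inj; apply/funext. Qed.

Lemma addBHE (S T : BH H) x : (S + T) x = S x + T x. Proof. by []. Qed.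
Lemma scaleBHE (a : R[i]) (T : BH H) x : (a *: T) x = a *: T x. Proof. by []. Qed.
Lemma oppBHE (T : BH H) x : (- T) x = - T x. Proof. by []. Qed.
Lemma BH0E x : (0 : BH H) x = 0. Proof. by []. Qed.
Lemma sumBHE (I : finType) (F : I -> BH H) x : (\sum_i F i) x = \sum_i F i x.
Proof. by apply: (big_morph (fun T : BH H => T x)). Qed.

Lemma BH_rnorm_bound (T : BH H) :
  exists2 M : R, 0 <= M & forall x : H, rnorm (T x) <= M * rnorm x.
Proof.
case: (BHP T) => _ [M TM]; exists `|M| => // x.
have := TM x; rewrite !rnormE -rmorphM /= lecR => /le_trans; apply.
by rewrite ler_wpM2r ?rnorm_ge0 ?ler_norm.
Qed.

Lemma rnorm_sum (I : finType) (F : I -> H) : rnorm (\sum_i F i) <= \sum_i rnorm (F i).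
Proof.
rewrite -lecR -rnormE rmorph_sum /=.
by apply: le_trans (ler_norm_sum _ _ _) _; apply: ler_sum => i _; rewrite rnormE.
Qed.

Lemma sqn_le_rnorm (x : H) (t : R) : 0 <= t -> (sqn x <= t ^+ 2) = (rnorm x <= t).
Proof. by move=> t0; rewrite ler_sqr ?nnegrE ?rnorm_ge0. Qed.

Lemma mxapp_bound n (A : 'M[BH H]_n) :
  exists2 M : R, 0 <= M & forall x, sqn_tuple (mxapp A x) <= M ^+ 2 * sqn_tuple x.
Proof.
have /choice[c cP] : forall ij : 'I_n * 'I_n, exists M : R,
    0 <= M /\ forall x : H, rnorm (A ij.1 ij.2 x) <= M * rnorm x.
  by move=> ij; have [M M0 AM] := BH_rnorm_bound (A ij.1 ij.2); exists M.
pose D := \sum_i (\sum_j c (i, j)) ^+ 2.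
have D0 : 0 <= D by apply: sumr_ge0 => i _; exact: sqr_ge0.
exists (Num.sqrt D); rewrite ?sqrtr_ge0// => x; rewrite sqr_sqrtr//.
rewrite /D mulr_suml; apply: ler_sum => i _.
rewrite -[sqn_tuple x]sqr_l2norm -exprMn sqn_le_rnorm; last first.
  by rewrite mulr_ge0 ?sqrtr_ge0// sumr_ge0// => j _; case: (cP (i, j)).
apply: le_trans (rnorm_sum _) _; rewrite mulr_suml; apply: ler_sum => j _.
have [c0 /(_ (x j))/= /le_trans] := cP (i, j); apply.
by rewrite ler_wpM2l// -sqn_le_rnorm ?sqrtr_ge0// sqr_l2norm sqn_le_tuple.
Qed.

Lemma sqn_tuple0 n : sqn_tuple (fun _ : 'I_n => 0 : H) = 0.
Proof. by apply: big1 => i _; exact: sqn0. Qed.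

Lemma mxapp0 n (A : 'M[BH H]_n) : mxapp A (fun=> 0) = fun=> 0.
Proof. by apply/funext => i; apply: big1 => j _; exact: BH0. Qed.

Let ball n := [set x : 'I_n -> H | l2norm x <= 1].

Lemma mxopnorm_has_sup n (A : 'M[BH H]_n) :
  has_sup [set l2norm (mxapp A x) | x in @ball n].
Proof.
split.
  exists 0; exists (fun=> 0) => /=.
    by rewrite /ball/= l2normE sqn_tuple0 sqrtr0.
  by rewrite mxapp0 l2normE sqn_tuple0 sqrtr0.
have [M M0 AM] := mxapp_bound A; exists M => _ [x x1 <-].
rewrite -(ler_sqr _ M0) ?nnegrE ?sqrtr_ge0// sqr_l2norm.
apply: le_trans (AM x) _; rewrite ler_piMr ?sqr_ge0//.
by rewrite -sqr_l2norm -(expr1n _ 2) ler_sqr ?nnegrE ?sqrtr_ge0.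
Qed.

Lemma mxopnorm_ge0 n (A : 'M[BH H]_n) : 0 <= mxopnorm A.
Proof.
have [_ ub] := mxopnorm_has_sup A; apply: (ub_le_sup ub).
exists (fun=> 0) => /=; first by rewrite /ball/= l2normE sqn_tuple0 sqrtr0.
by rewrite -/(mxapp A (fun=> 0)) mxapp0 l2normE sqn_tuple0 sqrtr0.
Qed.

Lemma mxappZ n (A : 'M[BH H]_n) (a : R[i]) x :
  mxapp A (fun i => a *: x i) = fun i => a *: mxapp A x i.
Proof.
by apply/funext => i; rewrite scaler_sumr; apply: eq_bigr => j _; exact: BHZ.
Qed.

Lemma mxopnorm_bound n (A : 'M[BH H]_n) x :
  sqn_tuple (mxapp A x) <= mxopnorm A ^+ 2 * sqn_tuple x.
Proof.
have [x0|x0] := eqVneq (sqn_tuple x) 0.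
  have -> : x = (fun=> 0).
    apply/funext => i; apply/sqn_eq0/eqP; rewrite eq_le sqn_ge0 andbT -x0.
    exact: sqn_le_tuple.
  by rewrite mxapp0 sqn_tuple0 mulr0.
have l0 : 0 < l2norm x.
  by rewrite lt_neqAle sqrtr_ge0 andbT eq_sym -sqrf_eq0 sqr_l2norm.
have [_ ub] := mxopnorm_has_sup A.
set y := (fun i => (l2norm x)^-1%:C *: x i).
have y1 : sqn_tuple y = 1.
  by rewrite sqn_tupleZ -sqr_l2norm -exprMn mulVf ?expr1n ?gt_eqF.
have /(ub_le_sup ub) : [set l2norm (mxapp A x) | x in @ball n] (l2norm (mxapp A y)).
  by exists y; rewrite //= /ball/= l2normE y1 sqrtr1.
rewrite -/(mxopnorm A) -ler_sqr ?nnegrE ?sqrtr_ge0 ?mxopnorm_ge0// sqr_l2norm.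
rewrite mxappZ sqn_tupleZ exprVn sqr_l2norm mulrC ler_pdivrMr//.
by rewrite -sqr_l2norm exprn_gt0.
Qed.

Lemma mxopnorm_le n (A : 'M[BH H]_n) (M : R) : 0 <= M ->
  (forall x, sqn_tuple (mxapp A x) <= M ^+ 2 * sqn_tuple x) -> mxopnorm A <= M.
Proof.
move=> M0 AM; apply: ge_sup; first by case: (mxopnorm_has_sup A).
move=> _ [x x1 <-]; rewrite -/(mxapp A x).
rewrite -(ler_sqr _ M0) ?nnegrE ?sqrtr_ge0// sqr_l2norm.
apply: le_trans (AM x) _; rewrite ler_piMr ?sqr_ge0//.
by rewrite -sqr_l2norm -(expr1n _ 2) ler_sqr ?nnegrE ?sqrtr_ge0.
Qed.

Lemma mxopnorm_le1 n (A : 'M[BH H]_n) : mxopnorm A <= 1 <-> contractive_mx A.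
Proof.
split=> [A1 x|Ac]; last by apply: mxopnorm_le => // x; rewrite expr1n mul1r.
apply: le_trans (mxopnorm_bound A x) _; rewrite ler_piMl ?sqn_tuple_ge0//.
by rewrite -(expr1n _ 2) ler_sqr ?nnegrE ?mxopnorm_ge0.
Qed.

Lemma mxapp_scale n (A : 'M[BH H]_n) (a : R[i]) x :
  mxapp (map_mx ( *:%R a) A) x = fun i => a *: mxapp A x i.
Proof.
by apply/funext => i; rewrite scaler_sumr; apply: eq_bigr => j _; rewrite mxE.
Qed.

Lemma contractive_scale n (A : 'M[BH H]_n) (M : R) : 0 < M ->
  contractive_mx (map_mx ( *:%R (M^-1)%:C) A) <->
  (forall x, sqn_tuple (mxapp A x) <= M ^+ 2 * sqn_tuple x).
Proof.
move=> M0; have M20 := exprn_gt0 2 M0.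
have E x : (sqn_tuple (mxapp (map_mx ( *:%R (M^-1)%:C) A) x) <= sqn_tuple x) =
    (sqn_tuple (mxapp A x) <= M ^+ 2 * sqn_tuple x).
  by rewrite mxapp_scale sqn_tupleZ exprVn ler_pdivrMl.
by split=> AM x; have := AM x; rewrite E.
Qed.

End Tuples.

Section CompleteContractions.
Context {R : realType} {H K : hilbertType R}.
Implicit Types (W : set (BH H)) (Y : set (BH K)) (f : BH H -> BH K).

(** By homogeneity it is enough to test a linear map on contractive matrices. *)
Lemma completely_contractiveP W Y f : operator_space W ->
  completely_contractive W Y f <->
  [/\ linear_on W f, (forall x, W x -> Y (f x)) &
    forall n (A : 'M[BH H]_n), matrices_over W A -> contractive_mx A ->
      contractive_mx (map_mx f A)].
Proof.
move=> [W0 Wlin]; split=> -[fl fY fc]; split=> // n A WA.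
  by move=> /mxopnorm_le1 A1; apply/mxopnorm_le1/(le_trans (fc n A WA)).
apply/ler_addgt0Pl => e e0.
have M0 : 0 < e + mxopnorm A by rewrite ltr_pwDl// mxopnorm_ge0.
apply: mxopnorm_le; first exact: ltW.
have f0 : f 0 = 0.
  by have := fl (-1) 0 0 W0 W0; rewrite scaler0 addr0 scaleN1r addNr.
have fZ (a : R[i]) x : W x -> f (a *: x) = a *: f x.
  by move=> Wx; rewrite -[a *: x]addr0 fl// f0 addr0.
apply/(contractive_scale _ M0).
have -> : map_mx ( *:%R ((e + mxopnorm A)^-1)%:C) (map_mx f A) =
    map_mx f (map_mx ( *:%R ((e + mxopnorm A)^-1)%:C) A).
  by apply/matrixP => i j; rewrite !mxE fZ.
apply: fc; first by move=> i j; rewrite mxE -[_ *: _]addr0; apply: Wlin.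
apply/contractive_scale => // x; apply: le_trans (mxopnorm_bound A x) _.
rewrite ler_wpM2r ?sqn_tuple_ge0// ler_sqr ?nnegrE ?mxopnorm_ge0//; last exact: ltW.
by rewrite lerDr ltW.
Qed.

End CompleteContractions.

(** * The Riesz representation theorem *)
Section Riesz.
Context {R : realType} {H : hilbertType R}.

Lemma sqnB_parallelogram (x y : H) :
  sqn (x - y) = 2 * sqn x + 2 * sqn y - 4 * sqn (2^-1%:C *: (x + y)).
Proof.
rewrite sqnZr !sqnD sqnN innerNr raddfN /=; lra.
Qed.

(** The representing vector minimizes Q y = ||y||^2 - 2 Re phi(y), and the
    hypothesis says exactly that Q is bounded below.  By the parallelogram law
    the sublevel sets of Q just above its infimum m form a Cauchy filter. *)
Lemma riesz (phi : H -> R[i]) (c : R) :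
  (forall a x y, phi (a *: x + y) = a * phi x + phi y) ->
  (forall y, 2 * Re (phi y) <= sqn y + c) ->
  exists z, forall y, phi y = inner y z.
Proof.
move=> lphi phic.
pose Q y := sqn y - 2 * Re (phi y).
have Qlb : has_inf (range Q).
  split; first by exists (Q 0); exists 0.
  by exists (- c) => _ [y _ <-]; rewrite /Q; have := phic y; lra.
pose m := inf (range Q).
have mQ y : m <= Q y by apply: ge_inf; [exact: Qlb.2|exists y].
have phi0 : phi 0 = 0.
  by have := lphi (-1) 0 0; rewrite scaler0 addr0 mulN1r addNr.
have phiZ a x : phi (a *: x) = a * phi x by rewrite -[a *: x]addr0 lphi phi0 addr0.
have phiD x y : phi (x + y) = phi x + phi y by rewrite -[x]scale1r lphi mul1r scale1r.
have near_min x y : sqn (x - y) <= 2 * (Q x - m) + 2 * (Q y - m).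
  have := mQ (2^-1%:C *: (x + y)); rewrite /Q sqnB_parallelogram phiZ phiD Re_realM.
  by rewrite raddfD /=; lra.
pose F := filter_from [set e : R | 0 < e] (fun e => [set y | Q y < m + e]).
have FF : ProperFilter F.
  apply: filter_from_proper; last first.
    move=> e /= e0; have [_ [y _ <-] ye] := inf_adherent e0 Qlb.
    by exists y.
  apply: filter_from_filter; first by exists 1 => /=.
  move=> d e /= d0 e0; exists (Num.min d e); first by rewrite /= lt_min d0.
  move=> y /= yde; split=> /=; apply: (lt_le_trans yde); rewrite lerD2l.
    by rewrite ge_min lexx.
  by rewrite ge_min lexx orbT.
have Fcauchy : cauchy F.
  apply: cauchy_exP => e; rewrite ltcE => /andP[/eqP Ie e0].
  have eE : e = (Re e)%:C by case: e Ie {e0} => u v /= ->.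
  have d0 : 0 < Re e ^+ 2 / 4 by rewrite divr_gt0// exprn_gt0.
  have [_ [y _ <-] ye] := inf_adherent d0 Qlb.
  exists y; exists (Re e ^+ 2 / 4) => // x /= xe.
  rewrite -ball_normE /= rnormE eE ltcR -ltr_sqr ?nnegrE ?rnorm_ge0//; last exact: ltW.
  apply: le_lt_trans (near_min _ _) _; move: xe ye; rewrite -/m; lra.
have := @cauchy_cvg H F FF Fcauchy.
set z := lim F => zF.
have zlim e : 0 < e -> exists u, sqn (u - z) <= e ^+ 2 /\ Q u <= m + e.
  move=> e0; have : F (ball z e%:C) by apply: zF; apply: nbhsx_ballx; rewrite ltcR.
  case=> d /= d0 dz.
  have de0 : 0 < Num.min d e by rewrite lt_min d0.
  have [_ [u _ <-] ue] := inf_adherent de0 Qlb.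
  exists u; split.
    have /dz : Q u < m + d.
      by apply: lt_le_trans ue _; rewrite lerD2l ge_min lexx.
    rewrite -ball_normE /= rnormE ltcR => /ltW; rewrite -sqn_le_rnorm//; last exact: ltW.
    by rewrite -sqnN opprB.
  apply: (le_trans (ltW ue)); by rewrite lerD2l ge_min lexx orbT.
(* First variation of Q at the minimizer z in the direction h. *)
have Rez h : Re (phi h) = Re (inner h z).
  set D := Re (inner h z) - Re (phi h).
  suff D0 : D = 0 by apply/esym/eqP; rewrite -subr_eq0 -/D D0.
  have key t : 0 <= 2 * t ^+ 2 * sqn h + 2 * t * D.
    apply/ler_addgt0Pl => e e0.
    pose e' := Num.min (e / 2) 1.
    have e'0 : 0 < e' by rewrite lt_min ltr01 andbT divr_gt0.
    have e'1 : e' <= 1 by rewrite ge_min lexx orbT.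
    have e'e : e' <= e / 2 by rewrite ge_min lexx.
    have [u [uz Qu]] := zlim _ e'0.
    have e'2 : e' ^+ 2 <= e' by rewrite expr2 ler_piMr// ltW.
    have := mQ (t%:C *: h + u); have := Re_inner_le (t%:C *: h) (u - z).
    move: uz Qu; move: (sqn (u - z)) => s uz; rewrite /Q sqnD lphi.
    rewrite !innerDr !innerNr !innerZl !raddfD !raddfN /= !Re_realM sqnZr.
    rewrite /D; lra.
  have k0 : 0 < sqn h + 1 by rewrite ltr_wpDl ?sqn_ge0.
  (* This t makes the quadratic negative unless D = 0; the summand 1 keeps the
     denominator positive. *)
  have := key (- D / (sqn h + 1)).
  have -> : 2 * (- D / (sqn h + 1)) ^+ 2 * sqn h + 2 * (- D / (sqn h + 1)) * D =
      - (2 * (D / (sqn h + 1)) ^+ 2).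
    by field; rewrite gt_eqF.
  rewrite oppr_ge0 pmulr_rle0// => D2; apply/eqP.
  have : (D / (sqn h + 1)) ^+ 2 == 0 by rewrite eq_le D2 sqr_ge0.
  by rewrite sqrf_eq0 mulf_eq0 invr_eq0 (gt_eqF k0) orbF.
(* The imaginary parts follow from the real parts at - i y. *)
exists z => y; have := Rez y; have := Rez ((- 'i) *: y).
rewrite phiZ innerZl; case: (phi y) (inner y z) => a b [u v] /=.
by rewrite !oppr0 !mul0r !sub0r !mulNr !mul1r !opprK => -> ->.
Qed.

End Riesz.

(** * A Hahn-Banach theorem for cones *)
Section HahnBanach.
Context {R : realType} {X : lmodType R[i]}.
Implicit Types (S : X -> R -> Prop).

(** [S u c] reads: c is an admissible upper bound at u.  The last condition
    plays the role of lower boundedness of the sublinear functional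
    u |-> inf {c | S u c}, without naming it. *)
Definition epigraph_cone S : Prop :=
  [/\ forall u v c d, S u c -> S v d -> S (u + v) (c + d),
      forall u c t, 0 < t -> S u c -> S (t%:C *: u) (t * c) &
      forall c, S 0 c -> 0 <= c].

(** Working with cones rather than with functionals makes the upper bound of a
    chain a plain union. *)
Lemma epigraph_cone_max S0 : epigraph_cone S0 ->
  exists S, [/\ epigraph_cone S, forall u c, S0 u c -> S u c &
    forall S', epigraph_cone S' -> (forall u c, S u c -> S' u c) ->
      forall u c, S' u c -> S u c].
Proof.
move=> S0cone.
pose T := {S | epigraph_cone S /\ forall u c, S0 u c -> S u c}.
pose le (S S' : T) := `[< forall u c, sval S u c -> sval S' u c >].
have t0 : T by exists S0.
have [|r s t /asboolP rs /asboolP st||S Smax] := @ZL_preorder T t0 le.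
- by move=> S; apply/asboolP.
- by apply/asboolP => u c /rs/st.
- move=> A Atot; have [[a Aa]|A0] := pselect (exists a, A a); last first.
    by exists t0 => s As; case: A0; exists s.
  pose U u c := exists2 s, A s & sval s u c.
  have Ucone : epigraph_cone U /\ forall u c, S0 u c -> U u c.
    split; last by move=> u c S0u; exists a => //; apply: (svalP a).2.
    split=> [u v c d [s As su] [t At tv]|u c t tpos [s As su]|c [s As s0]].
    - have [/asboolP st|/asboolP ts] := Atot _ _ As At.
        by exists t => //; case: (svalP t) => -[+ _ _] _; apply=> //; exact: st.
      by exists s => //; case: (svalP s) => -[+ _ _] _; apply=> //; exact: ts.
    - by exists s => //; case: (svalP s) => -[_ + _] _; apply.
    - by case: (svalP s) => -[_ _ +] _; apply.
  by exists (exist _ U Ucone) => s As; apply/asboolP => u c su; exists s.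
case: S Smax => S [Scone S0S] Smax; exists S; split=> // S' S'cone SS' u c.
have S'P : epigraph_cone S' /\ forall u c, S0 u c -> S' u c.
  by split=> // v d /S0S /SS'.
have /asboolP := Smax (exist _ S' S'P) (introT (asboolP _) SS').
exact.
Qed.

(** In a maximal cone, the infimum f u of the bounds at u is itself the negative
    of a bound at - u, since the ray through (- u, - f u) can be added; so the
    cone is the epigraph of the real-linear functional f, and
    u |-> f u - i f (i u) is the complex-linear functional with real part f. *)
Theorem hahn_banach_cone S : epigraph_cone S -> (forall u, exists c, S u c) ->
  exists F : X -> R[i],
    (forall a u v, F (a *: u + v) = a * F u + F v) /\
    (forall u c, S u c -> Re (F u) <= c).
Proof.
move=> /epigraph_cone_max[S1 [Scone S0S Smax]] /choice[b bS0].
have bS u : S1 u (b u) by apply/S0S/bS0.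
have [SD SZ SP] := Scone.
pose E u := [set c | S1 u c].
have Einf u : has_inf (E u).
  split; first by exists (b u); exact: bS.
  exists (- b (- u)) => c Ec; have := SD _ _ _ _ Ec (bS (- u)).
  by rewrite subrr => /SP; lra.
pose f u := inf (E u).
have fle u c : S1 u c -> f u <= c by move=> Suc; apply: ge_inf; [exact: (Einf u).2|].
have SNf u : S1 (- u) (- f u).
  (* The cone generated by S1 and the ray through (- u, - f u). *)
  pose S' v c := S1 v c \/ exists t, 0 < t /\ exists2 w, v = w - t%:C *: u &
    exists2 d, c = d - t * f u & S1 w d \/ (w = 0 /\ d = 0).
  suff S'cone : epigraph_cone S'.
    apply: (Smax S') => //; first by move=> v c; left.
    right; exists 1; split => //; exists 0; first by rewrite scale1r sub0r.
    by exists 0; [rewrite mul1r sub0r|right].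
  have S'D1 v w c d : S1 v c -> S' w d -> S' (v + w) (c + d).
    move=> Sv [Sw|[t [t0 [w' -> [d' -> Sd]]]]]; first by left; exact: SD.
    right; exists t; split => //; exists (v + w'); first by rewrite addrA.
    exists (c + d'); first by rewrite addrA.
    by left; case: Sd => [Sd|[-> ->]]; [exact: SD|rewrite !addr0].
  split.
  - move=> v w c d [Sv|[t [t0 [v' -> [c' -> Sc]]]]]; first exact: S'D1.
    move=> [Sw|[s [s0 [w' -> [d' -> Sd]]]]].
      rewrite [v' - _ + w]addrC [c' - _ + d]addrC; apply: S'D1 => //.
      by right; exists t; split => //; exists v' => //; exists c'.
    right; exists (t + s); split; first exact: addr_gt0.
    exists (v' + w').
      by rewrite rmorphD /= scalerDl opprD addrACA.
    exists (c' + d'); first by rewrite mulrDl opprD addrACA.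
    case: Sc => [Sc|[-> ->]]; last by rewrite !add0r.
    by left; case: Sd => [Sd|[-> ->]]; [exact: SD|rewrite !addr0].
  - move=> v c r r0 [Sv|[t [t0 [v' -> [c' -> Sc]]]]]; first by left; exact: SZ.
    right; exists (r * t); split; first exact: mulr_gt0.
    exists (r%:C *: v'); first by rewrite scalerBr scalerA rmorphM.
    exists (r * c'); first by rewrite mulrBr mulrA.
    case: Sc => [Sc|[-> ->]]; first by left; exact: SZ.
    by right; rewrite scaler0 mulr0.
  - move=> c [|[t [t0 [w /esym/eqP]]]]; first exact: SP.
    rewrite subr_eq0 => /eqP -> [d -> [Sd|[/eqP]]]; last first.
      rewrite scaler_eq0 => /orP[/eqP t00|/eqP u0] d0.
        by case: t00 t0 => ->; rewrite ltxx.
      rewrite d0 sub0r oppr_ge0 pmulr_rle0//; apply/ler_addgt0Pl => e e0.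
      have b0 := SP _ (bS 0); have bp : 0 < b 0 + 1 by rewrite ltr_wpDl.
      have := SZ _ _ _ (divr_gt0 e0 bp) (bS 0); rewrite scaler0 u0 addr0.
      move=> /fle /le_trans; apply; rewrite mulrAC ler_pdivrMr// ler_wpM2l ?ltW//.
      by rewrite ltrDl.
    have t10 : 0 < t^-1 by rewrite invr_gt0.
    have := SZ _ _ _ t10 Sd; rewrite scalerA -rmorphM mulVf ?gt_eqF// scale1r.
    by move=> /fle; rewrite ler_pdivlMl// mulrC subr_ge0 mulrC.
have Sf u : S1 u (f u).
  have := SNf (- u); rewrite opprK => SfN.
  have := fle _ _ (SNf u); have := fle _ _ SfN => h1 h2.
  have h3 : - f u <= f (- u).
    apply: lb_le_inf; first by exists (b (- u)); exact: bS.
    move=> d Sd; rewrite lerNl; apply: lb_le_inf; first by exists (b u); exact: bS.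
    by move=> c Sc; have := SD _ _ _ _ Sc Sd; rewrite subrr => /SP; lra.
  by have -> : f u = - f (- u) by lra.
have fN u : f (- u) = - f u.
  have := SD _ _ _ _ (Sf u) (Sf (- u)); rewrite subrr => /SP; have := fle _ _ (SNf u); lra.
have fD u v : f (u + v) = f u + f v.
  have := fle _ _ (SD _ _ _ _ (Sf u) (Sf v)).
  have := fle _ _ (SD _ _ _ _ (SNf u) (SNf v)); rewrite -opprD fN; lra.
have fZpos t u : 0 < t -> f (t%:C *: u) = t * f u.
  move=> t0; have h := fle _ _ (SZ _ _ _ t0 (Sf u)).
  have := fle _ _ (SZ _ _ _ t0 (SNf u)); rewrite scalerN fN; lra.
have f0 : f 0 = 0 by have := fD 0 0; rewrite addr0; lra.
have fZ t u : f (t%:C *: u) = t * f u.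
  have [t0|t0|->] := ltgtP t 0; [|exact: fZpos|by rewrite scale0r f0 mul0r].
  have := fZpos (- t) u; rewrite oppr_gt0 t0 rmorphN /= scaleNr fN mulNr.
  by move=> /(_ isT)/oppr_inj.
exists (fun u => f u +i* - f ('i *: u)); split; last by move=> u c /S0S /fle.
move=> [a b'] u v.
have aE : a +i* b' = a%:C + b'%:C * 'i.
  by apply/eqP; rewrite eq_complex /=; apply/andP; split; apply/eqP; ring.
have iaE : 'i * (a +i* b') = a%:C * 'i + (- b')%:C.
  by apply/eqP; rewrite eq_complex /=; apply/andP; split; apply/eqP; ring.
rewrite scalerDr scalerA iaE {1}aE !scalerDl -!scalerA !fD !fZ /=.
by apply/eqP; rewrite eq_complex /=; apply/andP; split; apply/eqP; ring.
Qed.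

End HahnBanach.

(** * Orthogonalization of tuples by unitary matrices *)
Section Unitary.
Context {R : realType}.

Lemma sum_biorth (V : lmodType R[i]) n (c d : 'I_n -> 'I_n -> R[i])
    (F : 'I_n -> 'I_n -> V) :
  (forall l m, \sum_j c j l * d j m = (l == m)%:R) ->
  \sum_j \sum_l \sum_m (c j l * d j m) *: F l m = \sum_l F l l.
Proof.
move=> cd; rewrite exchange_big; apply: eq_bigr => l _ /=.
rewrite exchange_big (bigD1 l) //= -scaler_suml cd eqxx scale1r.
rewrite big1 ?addr0// => m ml; rewrite -scaler_suml cd eq_sym.
by rewrite (negPf ml) scale0r.
Qed.

Lemma unitary_cols n (P : 'M[R[i]]_n) : P \is unitarymx ->
  forall l m, \sum_j P j l * (P j m)^* = (l == m)%:R.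
Proof.
move=> /unitarymxP/mulmx1C/matrixP PP l m; have := PP m l.
rewrite !mxE eq_sym => <-; apply: eq_bigr => j _; rewrite !mxE mulrC //.
Qed.

Definition mxact (H : hilbertType R) n (P : 'M[R[i]]_n) (x : 'I_n -> H) :
  'I_n -> H := fun i => \sum_j P i j *: x j.

Lemma sqn_mxact (H : hilbertType R) n (P : 'M[R[i]]_n) (x : 'I_n -> H) :
  P \is unitarymx -> sqn_tuple (mxact P x) = sqn_tuple x.
Proof.
move=> Pu; have E (y : 'I_n -> H) : sqn_tuple y = Re (\sum_i inner (y i) (y i)).
  by rewrite raddf_sum; apply: eq_bigr => i _; exact: sqnE.
rewrite !E; congr Re.
rewrite -(@sum_biorth R[i]^o n (fun j l => P j l) (fun j m => (P j m)^*)
  (fun l m => inner (x l) (x m)) (unitary_cols Pu)).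
apply: eq_bigr => i _; rewrite inner_suml; apply: eq_bigr => l _.
rewrite inner_sumr; apply: eq_bigr => m _.
by rewrite innerZl innerZr mulrA.
Qed.

(** The unitary comes from the spectral theorem for the Gram matrix of x. *)
Lemma orthogonalizing_unitary (H : hilbertType R) n (x : 'I_n -> H) :
  exists2 P : 'M[R[i]]_n, P \is unitarymx &
    forall i j, i != j -> inner (mxact P x i) (mxact P x j) = 0.
Proof.
pose G := \matrix_(i, j) inner (x i) (x j) : 'M[R[i]]_n.
have Gh : G \is hermsymmx.
  apply/sesquiP; rewrite expr0 scale1r; apply/matrixP => i j; rewrite !mxE.
  exact: innerC.
have /orthomx_spectralP GE := hermitian_normalmx Gh.
have Pu := spectral_unitarymx G; set P := spectralmx G in GE Pu *.
exists P => // i j ij.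
have PGP : P *m G *m P^t* = diag_mx (spectral_diag G).
  rewrite [X in _ *m X *m _]GE invmx_unitary// !mulmxA (unitarymxP Pu) mul1mx.
  by rewrite -mulmxA (unitarymxP Pu) mulmx1.
have : (P *m G *m P^t*) i j = 0 by rewrite PGP !mxE (negPf ij) mulr0n.
rewrite mxE => <-; rewrite inner_sumr; apply: eq_bigr => m _.
rewrite innerZr !mxE mulrC; congr (_ * _); rewrite inner_suml.
by apply: eq_bigr => l _; rewrite innerZl mxE.
Qed.

End Unitary.

(** * Factorizations of tensors *)
Section Factorizations.
Context {R : realType} {L H : hilbertType R}.

(** Stands for the element sum_(i, j) y_i^* (x) w_(i, j) (x) x_j of the tensor
    product of the dual of H, B(L) and H. *)
Record factorization := Factorization {
  fsize : nat;
  fmx : 'M[BH L]_fsize;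
  fright : 'I_fsize -> H;
  fleft : 'I_fsize -> H }.

Arguments fmx : clear implicits.
Arguments fright : clear implicits.
Arguments fleft : clear implicits.

Implicit Types (r : factorization) (W : set (BH L)).

(** The additive form of the Haagerup bound ||y|| ||w|| ||x||; it is only
    meaningful when w is contractive. *)
Definition cost r : R := (sqn_tuple (fright r) + sqn_tuple (fleft r)) / 2.

(** Linearity in T is only asked on W, because the complete contractions to be
    extended are only linear there. *)
Definition trilinear_on W (V : lmodType R[i]) (b : BH L -> H -> H -> V) : Prop :=
  [/\ forall a S T x y, W S -> W T -> b (a *: S + T) x y = a *: b S x y + b T x y,
      forall a T x x' y, W T -> b T (a *: x + x') y = a *: b T x y + b T x' y &
      forall a T x y y', W T -> b T x (a *: y + y') = a^* *: b T x y + b T x y'].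

Definition pairing (V : lmodType R[i]) (b : BH L -> H -> H -> V) r : V :=
  \sum_i \sum_j b (fmx r i j) (fright r j) (fleft r i).

(** Models the algebraic tensor product inside a function space: pairing x and
    y against test vectors h and k is injective on tensors.  Hence two
    factorizations are equivalent exactly when their [tensor]s are equal
    functions. *)
Definition elementary (T : BH L) (x y : H) : H -> H -> BH L :=
  fun h k => (inner x h * inner k y) *: T.

Definition tensor r : H -> H -> BH L := pairing elementary r.

Lemma tensorE r h k : tensor r h k =
  \sum_i \sum_j (inner (fright r j) h * inner k (fleft r i)) *: fmx r i j.
Proof.
rewrite /tensor /pairing !fct_sumE; apply: eq_bigr => i _.
by rewrite !fct_sumE.
Qed.

Lemma trilinear_elementary W : trilinear_on W elementary.
Proof.
split=> [a S T x y _ _|a T x x' y _|a T x y y' _]; apply/funext => h;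
    apply/funext => k; rewrite /elementary !fctE /=.
- by rewrite scalerDr !scalerA mulrC.
- by rewrite innerDl innerZl mulrDl scalerDl scalerA mulrA.
- by rewrite innerDr innerZr mulrDr scalerDl mulrCA scalerA.
Qed.

Section Trilinear.
Variables (W : set (BH L)) (V : lmodType R[i]) (b : BH L -> H -> H -> V).
Hypotheses (Wop : operator_space W) (btri : trilinear_on W b).

Lemma op0 : W 0. Proof. by case: Wop. Qed.
Lemma opZ a T : W T -> W (a *: T).
Proof. by move=> WT; rewrite -[_ *: _]addr0; case: Wop => W0; apply. Qed.
Lemma opD S T : W S -> W T -> W (S + T).
Proof. by move=> WS WT; rewrite -[S]scale1r; case: Wop => _; apply. Qed.
Lemma op_sum (I : finType) (F : I -> BH L) : (forall i, W (F i)) -> W (\sum_i F i).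
Proof. by move=> WF; elim/big_ind: _ => //; [exact: op0|exact: opD]. Qed.

Lemma tri0 x y : b 0 x y = 0.
Proof.
by case: btri => /(_ (-1) 0 0 x y op0 op0); rewrite scaler0 addr0 scaleN1r addNr.
Qed.
Lemma tri0l T y : W T -> b T 0 y = 0.
Proof.
by case: btri => _ /(_ (-1) T 0 0 y)+ _ => /[apply]; rewrite scaler0 addr0 scaleN1r addNr.
Qed.
Lemma tri0r T x : W T -> b T x 0 = 0.
Proof.
case: btri => _ _ /(_ (-1) T x 0 0)/[apply].
by rewrite scaler0 addr0 rmorphN1 scaleN1r addNr.
Qed.
Lemma triZ a T x y : W T -> b (a *: T) x y = a *: b T x y.
Proof.
by move=> WT; case: btri => /(_ a T 0 x y WT op0) + _ _; rewrite tri0 !addr0.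
Qed.
Lemma triZl a T x y : W T -> b T (a *: x) y = a *: b T x y.
Proof.
by move=> WT; case: btri => _ /(_ a T x 0 y WT) + _; rewrite tri0l// !addr0.
Qed.
Lemma triZr a T x y : W T -> b T x (a *: y) = a^* *: b T x y.
Proof.
by move=> WT; case: btri => _ _ /(_ a T x y 0 WT); rewrite tri0r// !addr0.
Qed.
Lemma tri_sum (I : finType) (F : I -> BH L) x y : (forall i, W (F i)) ->
  b (\sum_i F i) x y = \sum_i b (F i) x y.
Proof.
move=> WF; suff [] : W (\sum_i F i) /\ b (\sum_i F i) x y = \sum_i b (F i) x y by [].
elim/big_rec2: _ => [|i v S _ [WS bS]]; first by split; [exact: op0|exact: tri0].
split; first exact: opD.
by case: btri => /(_ 1 (F i) S x y (WF i) WS) + _ _; rewrite !scale1r bS.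
Qed.
Lemma tri_suml (I : finType) (F : I -> H) T y : W T ->
  b T (\sum_i F i) y = \sum_i b T (F i) y.
Proof.
move=> WT; apply: (big_morph (fun x => b T x y)); last exact: tri0l.
by move=> x x'; rewrite -[x]scale1r; case: btri => _ -> // _; rewrite !scale1r.
Qed.
Lemma tri_sumr (I : finType) (F : I -> H) T x : W T ->
  b T x (\sum_i F i) = \sum_i b T x (F i).
Proof.
move=> WT; apply: (big_morph (b T x)); last exact: tri0r.
move=> y y'; rewrite -[y]scale1r; case: btri => _ _ -> //.
by rewrite rmorph1 !scale1r.
Qed.

End Trilinear.

Definition factor_rotate r (P Q : 'M[R[i]]_(fsize r)) : factorization :=
  @Factorization (fsize r)
    (\matrix_(i, j) \sum_k Q i k *: \sum_l (P j l)^* *: fmx r k l)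
    (mxact P (fright r)) (mxact Q (fleft r)).

Lemma pairing_rotate W (V : lmodType R[i]) (b : BH L -> H -> H -> V) r
    (P Q : 'M[R[i]]_(fsize r)) :
  operator_space W -> trilinear_on W b -> matrices_over W (fmx r) ->
  P \is unitarymx -> Q \is unitarymx ->
  pairing b (factor_rotate P Q) = pairing b r.
Proof.
move=> Wop btri Wr Pu Qu; rewrite /pairing /=.
have Wsum j k : W (\sum_l (P j l)^* *: fmx r k l).
  by apply: op_sum => // l; apply: opZ.
transitivity (\sum_j \sum_k b (\sum_l (P j l)^* *: fmx r k l)
    (mxact P (fright r) j) (fleft r k)).
  rewrite exchange_big; apply: eq_bigr => j _ /=.
  rewrite -(sum_biorth (fun k p => b (\sum_l (P j l)^* *: fmx r k l)
    (mxact P (fright r) j) (fleft r p)) (unitary_cols Qu)).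
  apply: eq_bigr => i _; rewrite mxE (tri_sum Wop btri); last by move=> k; exact: opZ.
  apply: eq_bigr => k _; rewrite (triZ Wop btri)// (tri_sumr btri)// scaler_sumr.
  by apply: eq_bigr => p _; rewrite (triZr btri)// scalerA.
rewrite exchange_big; apply: eq_bigr => k _ /=.
have Pu' l m : \sum_j (P j l)^* * P j m = (l == m)%:R.
  by rewrite eq_sym -(unitary_cols Pu); apply: eq_bigr => j _; rewrite mulrC.
rewrite -(sum_biorth (fun l m => b (fmx r k l) (fright r m) (fleft r k)) Pu').
apply: eq_bigr => j _; rewrite (tri_sum Wop btri); last by move=> l; exact: opZ.
apply: eq_bigr => l _; rewrite (triZ Wop btri)// (tri_suml btri)// scaler_sumr.
by apply: eq_bigr => m _; rewrite (triZl btri)// scalerA.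
Qed.

(** The rotated matrix is w multiplied on both sides by scalar unitaries, which
    preserve the norm of tuples. *)
Lemma contractive_rotate r (P Q : 'M[R[i]]_(fsize r)) :
  P \is unitarymx -> Q \is unitarymx ->
  contractive_mx (fmx r) -> contractive_mx (fmx (factor_rotate P Q)).
Proof.
move=> Pu Qu rc z /=.
have -> : mxapp (\matrix_(i, j) \sum_k Q i k *: \sum_l (P j l)^* *: fmx r k l) z =
    mxact Q (mxapp (fmx r) (mxact (P^t*) z)).
  apply/funext => i; rewrite /mxapp /mxact.
  transitivity (\sum_j \sum_k Q i k *: \sum_l (P j l)^* *: fmx r k l (z j)).
    apply: eq_bigr => j _; rewrite mxE sumBHE; apply: eq_bigr => k _.
    by rewrite scaleBHE sumBHE.
  rewrite exchange_big; apply: eq_bigr => k _ /=; rewrite -scaler_sumr; congr (_ *: _).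
  rewrite exchange_big; apply: eq_bigr => l _ /=; rewrite BH_sum.
  by apply: eq_bigr => j _; rewrite BHZ !mxE.
rewrite sqn_mxact//; apply: le_trans (rc _) _.
by rewrite sqn_mxact// trmxC_unitary.
Qed.

(** The rows and columns facing a zero vector do not contribute to the tensor;
    clearing them is what lets the tensor determine the whole matrix. *)
Definition factor_prune r : factorization :=
  @Factorization (fsize r)
    (\matrix_(i, j) if (fright r j == 0) || (fleft r i == 0) then 0 else fmx r i j)
    (fright r) (fleft r).

Lemma pairing_prune W (V : lmodType R[i]) (b : BH L -> H -> H -> V) r :
  operator_space W -> trilinear_on W b -> matrices_over W (fmx r) ->
  pairing b (factor_prune r) = pairing b r.
Proof.
move=> Wop btri Wr; apply: eq_bigr => i _; apply: eq_bigr => j _ /=; rewrite mxE.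
have [->|x0] /= := eqVneq (fright r j) 0; first by rewrite (tri0 Wop btri) (tri0l btri).
have [->|y0] //= := eqVneq (fleft r i) 0; by rewrite (tri0 Wop btri) (tri0r btri).
Qed.

Lemma contractive_prune r : contractive_mx (fmx r) -> contractive_mx (fmx (factor_prune r)).
Proof.
move=> rc z /=.
pose z' j := if fright r j == 0 then 0 else z j.
apply: (@le_trans _ _ (sqn_tuple z')); last first.
  by apply: ler_sum => j _; rewrite /z'; case: ifP => // _; rewrite sqn0 sqn_ge0.
apply: le_trans (rc z'); apply: ler_sum => i _; rewrite /mxapp /=.
have [y0|y0] := eqVneq (fleft r i) 0.
  rewrite big1 ?sqn0 ?sqn_ge0// => j _.
  by rewrite mxE y0 eqxx orbT.
rewrite le_eqVlt; apply/orP; left; apply/eqP; congr sqn.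
apply: eq_bigr => j _; rewrite mxE (negPf y0) orbF /z'.
by case: ifP => // _; rewrite BH0.
Qed.

(** Testing against the vectors of the factorization itself isolates a single
    entry of the matrix. *)
Lemma tensor_orthogonal r :
  (forall i j, i != j -> inner (fright r i) (fright r j) = 0) ->
  (forall i j, i != j -> inner (fleft r i) (fleft r j) = 0) ->
  forall i j, tensor r (fright r j) (fleft r i) =
    (sqn (fright r j) * sqn (fleft r i))%:C *: fmx r i j.
Proof.
move=> xo yo i j; rewrite tensorE (bigD1 i)//= [X in _ + X]big1 ?addr0; last first.
  by move=> k ki; rewrite big1// => l _; rewrite yo 1?eq_sym// mulr0 scale0r.
rewrite (bigD1 j)//= big1 ?addr0; last by move=> l lj; rewrite xo// mul0r scale0r.
by rewrite !innerxx -rmorphM.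
Qed.

(** Rotating x and y to orthogonal tuples and pruning makes the matrix readable
    from the tensor.  The third clause is the point: it puts the entries in
    every operator space that contains the values of the tensor. *)
Lemma orthogonal_factorization r : exists r',
  [/\ cost r' = cost r,
      contractive_mx (fmx r) -> contractive_mx (fmx r'),
      forall i j, exists a h k, fmx r' i j = a *: tensor r h k &
      forall W (V : lmodType R[i]) (b : BH L -> H -> H -> V),
        operator_space W -> trilinear_on W b -> matrices_over W (fmx r) ->
        pairing b r' = pairing b r].
Proof.
have [P Pu xo] := orthogonalizing_unitary (fright r).
have [Q Qu yo] := orthogonalizing_unitary (fleft r).
pose r1 := factor_rotate P Q.
have setT_op : operator_space [set: BH L] by [].
have ten1 : tensor (factor_prune r1) = tensor r.
  rewrite /tensor (pairing_prune setT_op (trilinear_elementary _))//.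
  by rewrite (pairing_rotate setT_op (trilinear_elementary _)).
exists (factor_prune r1); split.
- by rewrite /cost /= !sqn_mxact.
- by move=> rc; apply/contractive_prune/contractive_rotate.
- move=> i j; have := @tensor_orthogonal (factor_prune r1) xo yo i j.
  rewrite ten1; set x := fright _ _; set y := fleft _ _; set T := fmx _ _ _ => E.
  have [x0|x0] := eqVneq x 0.
    by exists 0, 0, 0; rewrite scale0r /T mxE -/x x0 eqxx.
  have [y0|y0] := eqVneq y 0.
    by exists 0, 0, 0; rewrite scale0r /T mxE -/y y0 eqxx orbT.
  exists ((sqn x * sqn y)^-1)%:C, x, y; rewrite E scalerA -rmorphM mulVf ?scale1r//.
  by rewrite mulf_neq0//; [move: x0|move: y0]; apply: contra_neq; exact: sqn_eq0.
- move=> W V b Wop btri Wr; rewrite (pairing_prune Wop btri) ?pairing_rotate//.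
    exact: (pairing_rotate Wop btri).
  move=> i j; rewrite mxE; apply: op_sum => // k; apply: opZ => //.
  by apply: op_sum => // l; apply: opZ.
Qed.

End Factorizations.

Arguments fmx {R L H} _.
Arguments fright {R L H} _ _.
Arguments fleft {R L H} _ _.

(** * Operations on factorizations and injectivity of the Haagerup norm *)
Section FactorizationAlgebra.
Context {R : realType} {L H : hilbertType R}.
Implicit Types (r s : @factorization R L H) (W : set (BH L)).

Definition tuple_cat (T : Type) m n (x : 'I_m -> T) (y : 'I_n -> T) : 'I_(m + n) -> T :=
  fun k => match fintype.split k with inl i => x i | inr j => y j end.

Lemma tuple_catl (T : Type) m n (x : 'I_m -> T) (y : 'I_n -> T) i :
  tuple_cat x y (lshift n i) = x i.
Proof. by rewrite /tuple_cat (unsplitK (inl i)). Qed.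

Lemma tuple_catr (T : Type) m n (x : 'I_m -> T) (y : 'I_n -> T) i :
  tuple_cat x y (rshift m i) = y i.
Proof. by rewrite /tuple_cat (unsplitK (inr i)). Qed.

Lemma sqn_tuple_cat m n (x : 'I_m -> H) (y : 'I_n -> H) :
  sqn_tuple (tuple_cat x y) = sqn_tuple x + sqn_tuple y.
Proof.
rewrite /sqn_tuple big_split_ord /=; congr (_ + _); apply: eq_bigr => i _.
  by rewrite tuple_catl.
by rewrite tuple_catr.
Qed.

Definition factor_add r s : factorization :=
  @Factorization R L H (fsize r + fsize s) (block_mx (fmx r) 0 0 (fmx s))
    (tuple_cat (fright r) (fright s)) (tuple_cat (fleft r) (fleft s)).

Definition factor_scale (a c : R[i]) r : factorization :=
  @Factorization R L H (fsize r) (fmx r)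
    (fun j => a *: fright r j) (fun i => c *: fleft r i).

Lemma over_block m n W (A : 'M[BH L]_m) (B : 'M[BH L]_n) : operator_space W ->
  matrices_over W A -> matrices_over W B -> matrices_over W (block_mx A 0 0 B).
Proof.
move=> [W0 _] WA WB i j; case: (split_ordP i) => i' ->; case: (split_ordP j) => j' ->;
  by rewrite (block_mxEul, block_mxEur, block_mxEdl, block_mxEdr) ?mxE.
Qed.

Lemma contractive_block m n (A : 'M[BH L]_m) (B : 'M[BH L]_n) :
  contractive_mx A -> contractive_mx B -> contractive_mx (block_mx A 0 0 B).
Proof.
move=> Ac Bc x.
pose x1 i := x (lshift n i); pose x2 j := x (rshift m j).
have xE : sqn_tuple x = sqn_tuple x1 + sqn_tuple x2.
  by rewrite /sqn_tuple big_split_ord.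
rewrite xE; apply: le_trans (lerD (Ac x1) (Bc x2)).
rewrite {1}/sqn_tuple big_split_ord /= /mxapp; apply: lerD; apply: ler_sum => i _.
  rewrite le_eqVlt; apply/orP; left; apply/eqP; congr sqn.
  rewrite big_split_ord /= [X in _ + X]big1 ?addr0; last first.
    by move=> j _; rewrite block_mxEur mxE.
  by apply: eq_bigr => j _; rewrite block_mxEul.
rewrite le_eqVlt; apply/orP; left; apply/eqP; congr sqn.
rewrite big_split_ord /= big1 ?add0r; last by move=> j _; rewrite block_mxEdl mxE.
by apply: eq_bigr => j _; rewrite block_mxEdr.
Qed.

Lemma cost_add r s : cost (factor_add r s) = cost r + cost s.
Proof. by rewrite /cost /= !sqn_tuple_cat; field. Qed.

Lemma cost_scale (t : R) r : cost (factor_scale t%:C t%:C r) = t ^+ 2 * cost r.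
Proof. by rewrite /cost /= !sqn_tupleZ; field. Qed.

Section Pairing.
Variables (W : set (BH L)) (V : lmodType R[i]) (b : BH L -> H -> H -> V).
Hypotheses (Wop : operator_space W) (btri : trilinear_on W b).

Lemma pairing_add r s :
  matrices_over W (fmx r) -> matrices_over W (fmx s) ->
  pairing b (factor_add r s) = pairing b r + pairing b s.
Proof.
move=> Wr Ws; rewrite /pairing /= big_split_ord /=; congr (_ + _);
    apply: eq_bigr => i _; rewrite big_split_ord /=.
  rewrite [X in _ + X]big1 ?addr0; last first.
    by move=> j _; rewrite block_mxEur mxE (tri0 Wop btri).
  by apply: eq_bigr => j _; rewrite block_mxEul !tuple_catl.
rewrite big1 ?add0r; last by move=> j _; rewrite block_mxEdl mxE (tri0 Wop btri).
by apply: eq_bigr => j _; rewrite block_mxEdr !tuple_catr.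
Qed.

Lemma pairing_scale (a c : R[i]) r : matrices_over W (fmx r) ->
  pairing b (factor_scale a c r) = (a * c^*) *: pairing b r.
Proof.
move=> Wr; rewrite /pairing /= scaler_sumr; apply: eq_bigr => i _.
rewrite scaler_sumr; apply: eq_bigr => j _.
by rewrite (triZl btri)// (triZr btri)// scalerA.
Qed.

Lemma pairing_opp r : matrices_over W (fmx r) ->
  pairing b (factor_scale (-1) 1 r) = - pairing b r.
Proof. by move=> Wr; rewrite pairing_scale// rmorph1 mulr1 scaleN1r. Qed.

(** Makes a trilinear form on W well defined on tensors over W: once the
    factorization is orthogonal, a zero tensor forces a zero matrix. *)
Lemma pairing_zero r : matrices_over W (fmx r) -> tensor r = 0 ->
  pairing b r = 0.
Proof.
move=> Wr r0; have [r' [_ _ r'E /(_ W V b Wop btri Wr) <-]] := orthogonal_factorization r.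
rewrite /pairing big1// => i _; rewrite big1// => j _.
by have [a [h [k ->]]] := r'E i j; rewrite r0 scaler0 (tri0 Wop btri).
Qed.

End Pairing.

Lemma setT_operator_space : operator_space [set: BH L]. Proof. by []. Qed.

Lemma tensor_add r s : tensor (factor_add r s) = tensor r + tensor s.
Proof. exact: (pairing_add setT_operator_space (trilinear_elementary _)). Qed.

Lemma tensor_scale (a c : R[i]) r : tensor (factor_scale a c r) = (a * c^*) *: tensor r.
Proof. exact: (pairing_scale (trilinear_elementary setT)). Qed.

Lemma pairing_tensor W (V : lmodType R[i]) (b : BH L -> H -> H -> V) r s :
  operator_space W -> trilinear_on W b ->
  matrices_over W (fmx r) -> matrices_over W (fmx s) -> tensor r = tensor s ->
  pairing b r = pairing b s.
Proof.
move=> Wop btri Wr Ws rs; apply/eqP; rewrite -subr_eq0; apply/eqP.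
rewrite -(pairing_opp btri)// -(pairing_add Wop btri)//.
apply: (pairing_zero Wop btri); first exact: over_block.
by rewrite tensor_add tensor_scale rs rmorph1 mulr1 scaleN1r subrr.
Qed.

(** The regular module is used as target so that the scaling of the values of
    the form is multiplication. *)
Definition mapform (f : BH L -> BH H) (T : BH L) (x y : H) : R[i]^o := inner (f T x) y.

Lemma trilinear_mapform W f : linear_on W f -> trilinear_on W (mapform f).
Proof.
move=> fl; split=> [a S T x y WS WT|a T x x' y _|a T x y y' _]; rewrite /mapform.
- by rewrite fl// addBHE scaleBHE innerDl innerZl.
- by rewrite BH_lin innerDl innerZl.
- by rewrite innerDr innerZr.
Qed.

(** The easy half of the correspondence between complete contractions and
    functionals bounded by the Haagerup norm. *)
Lemma Re_pairing_le (f : BH L -> BH H) r :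
  contractive_mx (map_mx f (fmx r)) -> Re (pairing (mapform f) r) <= cost r.
Proof.
move=> fr; have -> : pairing (mapform f) r =
    \sum_i inner (mxapp (map_mx f (fmx r)) (fright r) i) (fleft r i).
  apply: eq_bigr => i _; rewrite inner_suml; apply: eq_bigr => j _.
  by rewrite mxE.
rewrite /cost ler_pdivlMr// mulrC raddf_sum /= mulr_sumr.
apply: (@le_trans _ _ (sqn_tuple (mxapp (map_mx f (fmx r)) (fright r)) +
    sqn_tuple (fleft r))); last by rewrite lerD2r; exact: fr.
by rewrite /sqn_tuple -big_split; apply: ler_sum => i _; exact: Re_inner_le.
Qed.

(** Injectivity of the Haagerup tensor norm.  The competitor r ranges over all
    of B(L), where f need not be contractive nor even linear; but its orthogonal
    replacement has entries in W. *)
Lemma factorization_injectivity W (f : BH L -> BH H) r s : operator_space W ->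
  linear_on W f ->
  (forall n (A : 'M[BH L]_n), matrices_over W A -> contractive_mx A ->
      contractive_mx (map_mx f A)) ->
  contractive_mx (fmx r) -> matrices_over W (fmx s) -> tensor r = tensor s ->
  Re (pairing (mapform f) s) <= cost r.
Proof.
move=> Wop fl fc rc Ws rs.
have [r' [<- r'c r'E r'b]] := orthogonal_factorization r.
have Wr' : matrices_over W (fmx r').
  move=> i j; have [a [h [k ->]]] := r'E i j; apply: opZ => //.
  rewrite rs tensorE; apply: op_sum => // i'; apply: op_sum => // j'; exact: opZ.
have -> : pairing (mapform f) s = pairing (mapform f) r'.
  apply: (pairing_tensor Wop (trilinear_mapform fl)) => //.
  by rewrite -rs /tensor (r'b _ _ _ setT_operator_space (trilinear_elementary _)).
by apply: Re_pairing_le; apply: fc => //; apply: r'c.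
Qed.

(** The norm of the matrix is moved into the right-hand tuple; adding 1 keeps
    the scaling factor invertible. *)
Lemma contractive_factorization r :
  exists2 s, contractive_mx (fmx s) & tensor s = tensor r /\
    cost s = ((mxopnorm (fmx r) + 1) ^+ 2 * sqn_tuple (fright r) + sqn_tuple (fleft r)) / 2.
Proof.
pose M := mxopnorm (fmx r) + 1.
have M0 : 0 < M by rewrite ltr_wpDl// mxopnorm_ge0.
exists (@Factorization R L H (fsize r) (map_mx ( *:%R (M^-1)%:C) (fmx r))
    (fun j => M%:C *: fright r j) (fleft r)) => /=.
  apply/(contractive_scale _ M0) => x; apply: le_trans (mxopnorm_bound _ _) _.
  rewrite ler_wpM2r ?sqn_tuple_ge0// ler_sqr ?nnegrE ?mxopnorm_ge0//; last exact: ltW.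
  by rewrite lerDl.
split; last by rewrite /cost /= sqn_tupleZ.
apply/funext => h; apply/funext => k; rewrite !tensorE.
apply: eq_bigr => i _; apply: eq_bigr => j _ /=.
rewrite mxE scalerA innerZl; congr (_ *: _).
by rewrite mulrC !mulrA -rmorphM mulVf ?gt_eqF// mul1r.
Qed.

End FactorizationAlgebra.

(** * From cones of tensors to completely contractive maps *)
Section TensorSpace.
Context {R : realType} {L H : hilbertType R}.

Definition is_tensor : {pred H -> H -> BH L} :=
  fun u => `[< exists r : @factorization R L H, u = tensor r >].

Lemma is_tensor_submod : submod_closed is_tensor.
Proof.
split.
  apply/asboolP; exists (@Factorization R L H 0 0 (fun=> 0) (fun=> 0)).
  by apply/funext => h; apply/funext => k; rewrite tensorE big_ord0.
move=> a _ _ /asboolP[r ->] /asboolP[s ->]; apply/asboolP.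
by exists (factor_add (factor_scale a 1 r) s); rewrite tensor_add tensor_scale rmorph1 mulr1.
Qed.

HB.instance Definition _ :=
  GRing.isSubmodClosed.Build R[i] (H -> H -> BH L) is_tensor is_tensor_submod.

End TensorSpace.

Record tensor_space (R : realType) (L H : hilbertType R) := TensorSpace {
  tensor_fun : H -> H -> BH L;
  tensor_funP : tensor_fun \in is_tensor }.

HB.instance Definition _ (R : realType) (L H : hilbertType R) :=
  [isSub for @tensor_fun R L H].
HB.instance Definition _ (R : realType) (L H : hilbertType R) :=
  [Choice of tensor_space L H by <:].
HB.instance Definition _ (R : realType) (L H : hilbertType R) :=
  [SubChoice_isSubLmodule of tensor_space L H by <:].

Section MapsFromCones.
Context {R : realType} {L H : hilbertType R}.
Local Notation X := (tensor_space L H).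
Implicit Types (r : @factorization R L H).

Lemma tensor_mem r : tensor r \in is_tensor.
Proof. by apply/asboolP; exists r. Qed.

Definition tens r : X := TensorSpace (tensor_mem r).

Definition factor_elem (T : BH L) (x y : H) : factorization :=
  @Factorization R L H 1 (const_mx T) (fun=> x) (fun=> y).

Definition elem (T : BH L) (x y : H) : X := tens (factor_elem T x y).

Lemma pairing_elem (V : lmodType R[i]) (b : BH L -> H -> H -> V) T x y :
  pairing b (factor_elem T x y) = b T x y.
Proof. by rewrite /pairing /= !big_ord1 mxE. Qed.

Lemma val_elem T x y : val (elem T x y) = elementary T x y.
Proof. exact: pairing_elem. Qed.

Lemma trilinear_elem : trilinear_on setT elem.
Proof.
have [t1 t2 t3] := @trilinear_elementary R L H setT.
have valP a (u v : X) : val (a *: u + v) = a *: val u + val v by [].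
split=> *; apply: val_inj; rewrite valP !val_elem.
- exact: t1.
- exact: t2.
- exact: t3.
Qed.

Lemma tens_pairing r : tens r = pairing elem r.
Proof.
apply: val_inj; rewrite /pairing raddf_sum; apply: eq_bigr => i _.
by rewrite raddf_sum; apply: eq_bigr => j _; symmetry; exact: val_elem.
Qed.

Lemma tens_eq r s : (tens r = tens s) <-> (tensor r = tensor s).
Proof. by split=> [[]//|rs]; apply: val_inj. Qed.

Lemma tens_add r s : tens (factor_add r s) = tens r + tens s.
Proof. by apply: val_inj; exact: tensor_add. Qed.

Lemma tens_scale (a c : R[i]) r : tens (factor_scale a c r) = (a * c^*) *: tens r.
Proof. by apply: val_inj; exact: tensor_scale. Qed.

Lemma tens_contractive (u : X) : exists2 r, contractive_mx (fmx r) & u = tens r.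
Proof.
case: u => u /[dup] /asboolP[r uE] up.
by have [s sc [sr _]] := contractive_factorization r; exists s => //; apply: val_inj;
  rewrite /= uE.
Qed.

(** The functional F of the Hahn-Banach theorem gives the form
    (x, y) |-> F (y^* (x) T (x) x), which the Riesz theorem turns into an
    operator g T; the costs among the bounds make it bounded and make g
    completely contractive. *)
Lemma map_of_cone (S : X -> R -> Prop) : epigraph_cone S ->
  (forall r, contractive_mx (fmx r) -> S (tens r) (cost r)) ->
  exists2 g : BH L -> BH H, completely_contractive setT setT g &
    forall r c, S (tens r) c -> Re (pairing (mapform g) r) <= c.
Proof.
move=> Scone Scost.
have [|F [Flin Fle]] := hahn_banach_cone Scone.
  by move=> u; have [r rc ->] := tens_contractive u; exists (cost r); exact: Scost.
pose b T x y := F (elem T x y).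
have F0 : F 0 = 0 by have := Flin (-1) 0 0; rewrite scaler0 addr0 mulN1r addNr.
have FD u v : F (u + v) = F u + F v by rewrite -[u]scale1r Flin mul1r scale1r.
have [e1 e2 e3] := trilinear_elem.
have bound T x y : 2 * Re (b T x y) <=
    (mxopnorm (const_mx T : 'M[BH L]_1) + 1) ^+ 2 * sqn x + sqn y.
  have [s sc [sE scost]] := contractive_factorization (factor_elem T x y).
  have sE' : tens s = elem T x y by apply/tens_eq.
  have := Fle _ _ (Scost _ sc); rewrite sE'.
  by rewrite scost /sqn_tuple /= !big_ord1 -/(elem T x y) -/(b T x y); lra.
have /choice[g0 g0P] : forall Tx : BH L * H, exists z, forall y, b Tx.1 Tx.2 y = inner z y.
  move=> [T x]; have [|y|z zP] := @riesz _ H (fun y => (b T x y)^*%R)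
    ((mxopnorm (const_mx T : 'M[BH L]_1) + 1) ^+ 2 * sqn x).
  - by move=> a y y'; rewrite /b e3// Flin rmorphD rmorphM /= conjCK.
  - by have := bound T x y; rewrite addrC; case: (b T x y).
  - by exists z => y; rewrite innerC -zP conjCK.
have inner_inj (z z' : H) : (forall y, inner z y = inner z' y) -> z = z'.
  move=> zz'; apply/eqP; rewrite -subr_eq0; apply/eqP/sqn_eq0.
  by rewrite sqnE innerDl innerNl zz' subrr.
have g0_bounded T : (fun x => g0 (T, x)) \in bounded_operator.
  apply/asboolP; split.
    move=> a x x' /=; apply: inner_inj => y.
    by rewrite innerDl innerZl -!g0P /b /= e2// Flin.
  exists (mxopnorm (const_mx T : 'M[BH L]_1) + 1) => x.
  rewrite !rnormE -rmorphM /= lecR -sqn_le_rnorm; last first.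
    by rewrite mulr_ge0 ?rnorm_ge0 ?addr_ge0 ?mxopnorm_ge0.
  have := bound T x (g0 (T, x)).
  by rewrite (g0P (T, x)) -sqnE exprMn -/(sqn x); lra.
pose g T := MkBH (g0_bounded T).
have gE T x y : b T x y = inner (g T x) y by rewrite (g0P (T, x)).
have FE r : F (tens r) = pairing (mapform g) r.
  rewrite tens_pairing /pairing (big_morph F FD F0); apply: eq_bigr => i _.
  by rewrite (big_morph F FD F0); apply: eq_bigr => j _; rewrite -[LHS]/(b _ _ _) gE.
exists g; last by move=> r c Sc; rewrite -FE; exact: Fle.
apply/completely_contractiveP => //; split=> //.
  move=> a S' T _ _; apply: BH_ext => x; apply: inner_inj => y.
  by rewrite addBHE scaleBHE innerDl innerZl -!gE /b e1// Flin.
move=> n A _ Ac x; set y := mxapp _ x.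
(* Pairing the image y = (g A) x with itself: the bound by the cost reads
   ||y||^2 <= (||x||^2 + ||y||^2) / 2. *)
pose r := @Factorization R L H n A x y.
have := Fle _ _ (Scost r Ac); rewrite FE.
have -> : pairing (mapform g) r = \sum_i inner (y i) (y i).
  apply: eq_bigr => i _; rewrite {1}/y inner_suml; apply: eq_bigr => j _.
  by rewrite mxE.
rewrite raddf_sum /cost /=; under eq_bigr do rewrite -sqnE.
by rewrite -/(sqn_tuple y); lra.
Qed.

End MapsFromCones.

(** * Wittstock's extension theorem *)
Section Extension.
Context {R : realType} {L H : hilbertType R}.
Implicit Types (W : set (BH L)) (r s : @factorization R L H).

(** The inequality holds for all y, so testing at y = A x - B x suffices. *)
Lemma BH_le_eq (A B : BH H) :
  (forall x y, Re (inner (A x) y) <= Re (inner (B x) y)) -> A = B.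
Proof.
move=> AB; apply: BH_ext => x; apply/eqP; rewrite -subr_eq0; apply/eqP/sqn_eq0.
apply/eqP; rewrite eq_le sqn_ge0 andbT sqnE innerDl innerNl raddfB /=.
by rewrite subr_le0 AB.
Qed.

Lemma tens_elem0 : tens (factor_elem (0 : BH L) (0 : H) 0) = 0.
Proof.
by apply: val_inj; rewrite [LHS]val_elem; apply/funext => h; apply/funext => k;
  rewrite /elementary scaler0.
Qed.

Lemma tens_opp r : tens (factor_scale (-1) 1 r) = - tens r.
Proof. by rewrite tens_scale rmorph1 mulr1 scaleN1r. Qed.

(** Both tuples are scaled by the square root of t, so that the cost is scaled
    by t as well. *)
Lemma tens_scale_sqrt (t : R) r : 0 <= t ->
  tens (factor_scale (Num.sqrt t)%:C (Num.sqrt t)%:C r) = t%:C *: tens r.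
Proof.
by move=> t0; rewrite tens_scale [X in _ * X]conjc_real -rmorphM -expr2 sqr_sqrtr.
Qed.

Lemma cost_scale_sqrt (t : R) r : 0 <= t ->
  cost (factor_scale (Num.sqrt t)%:C (Num.sqrt t)%:C r) = t * cost r.
Proof. by move=> t0; rewrite cost_scale sqr_sqrtr. Qed.

Lemma Re_pairing_scale_sqrt W (f : BH L -> BH H) (t : R) r : 0 <= t ->
  linear_on W f -> matrices_over W (fmx r) ->
  Re (pairing (mapform f) (factor_scale (Num.sqrt t)%:C (Num.sqrt t)%:C r)) =
  t * Re (pairing (mapform f) r).
Proof.
move=> t0 fl Wr; rewrite (pairing_scale (trilinear_mapform fl))//.
by rewrite [X in _ * X]conjc_real -rmorphM -expr2 sqr_sqrtr// Re_realM.
Qed.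

Lemma Re_pairing_add W (f : BH L -> BH H) r s : operator_space W ->
  linear_on W f -> matrices_over W (fmx r) -> matrices_over W (fmx s) ->
  Re (pairing (mapform f) (factor_add r s)) =
  Re (pairing (mapform f) r) + Re (pairing (mapform f) s).
Proof.
move=> Wop fl Wr Ws.
by rewrite (pairing_add Wop (trilinear_mapform fl))// raddfD.
Qed.

(** Admissible bounds at u are the numbers cost r + Re f(s), for u = r + s with r
    contractive and s over W.  At u = 0 such a bound is nonnegative by
    [factorization_injectivity] applied to - s, which has the same tensor as
    r. *)
Theorem wittstock_extension W (f : BH L -> BH H) :
  operator_space W -> completely_contractive W setT f ->
  exists2 g, completely_contractive setT setT g & {in W, g =1 f}.
Proof.
move=> Wop /(completely_contractiveP _ _ Wop)[fl _ fc].
have btri := trilinear_mapform fl.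
pose z := factor_elem (0 : BH L) (0 : H) 0.
have W0 := op0 Wop.
have Wz : matrices_over W (fmx z) by move=> i j; rewrite mxE.
have zc : contractive_mx (fmx z).
  by move=> x; rewrite /sqn_tuple big1 ?sumr_ge0// => i _;
    rewrite ?sqn_ge0// /mxapp big1 ?sqn0// => j _; rewrite mxE.
pose S u c := exists r s, [/\ contractive_mx (fmx r), matrices_over W (fmx s),
  u = tens r + tens s & c = cost r + Re (pairing (mapform f) s)].
have Scone : epigraph_cone S.
  split.
  - move=> _ _ _ _ [r [s [rc Ws -> ->]]] [r' [s' [rc' Ws' -> ->]]].
    exists (factor_add r r'), (factor_add s s'); split.
    + exact: contractive_block.
    + exact: over_block.
    + by rewrite !tens_add addrACA.
    + by rewrite cost_add (Re_pairing_add Wop)// addrACA.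
  - move=> _ _ t t0 [r [s [rc Ws -> ->]]].
    exists (factor_scale (Num.sqrt t)%:C (Num.sqrt t)%:C r),
      (factor_scale (Num.sqrt t)%:C (Num.sqrt t)%:C s); split => //.
      by rewrite !tens_scale_sqrt ?scalerDr// ltW.
    by rewrite cost_scale_sqrt ?(Re_pairing_scale_sqrt _ fl) ?mulrDr// ltW.
  - move=> c [r [s [rc Ws /esym/eqP]]]; rewrite addr_eq0 -tens_opp => /eqP/tens_eq rs ->.
    have := factorization_injectivity Wop fl fc rc (_ : matrices_over W (fmx (factor_scale (-1) 1 s))) rs.
    by move=> /(_ Ws); rewrite (pairing_opp btri)// raddfN /=; lra.
have [r rc|g gcc gS] := map_of_cone Scone.
  exists r, z; split => //; first by rewrite tens_elem0 addr0.
  by rewrite pairing_elem /mapform inner0r addr0.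
exists g => // T; rewrite inE => WT; apply: BH_le_eq => x y.
have := gS (factor_elem T x y) (Re (inner (f T x) y)).
rewrite pairing_elem; apply.
exists z, (factor_elem T x y); split => //.
- by move=> i j; rewrite mxE.
- by rewrite tens_elem0 add0r.
- by rewrite pairing_elem /cost /= !sqn_tuple0 addr0 mul0r add0r.
Qed.

End Extension.

(** * Minimal projections *)
Section OperatorNorm.
Context {R : realType} {H : hilbertType R}.

Lemma opnormE (T : BH H) : opnorm T = mxopnorm (const_mx T : 'M[BH H]_1).
Proof.
have l2 (x : 'I_1 -> H) : l2norm x = rnorm (x ord0).
  by rewrite l2normE /sqn_tuple big_ord1 sqrtr_sqr ger0_norm// rnorm_ge0.
have app (x : 'I_1 -> H) : (\sum_j (const_mx T : 'M[BH H]_1) ord0 j (x j)) = T (x ord0).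
  by rewrite big_ord1 mxE.
congr sup; apply/seteqP; split=> _ [x x1 <-].
  by exists (fun=> x); rewrite /= l2 // app.
by exists (x ord0); rewrite /= -?l2// l2 app.
Qed.

Lemma opnorm_ge0 (T : BH H) : 0 <= opnorm T.
Proof. by rewrite opnormE mxopnorm_ge0. Qed.

Lemma opnorm_bound (T : BH H) x : sqn (T x) <= opnorm T ^+ 2 * sqn x.
Proof.
have := mxopnorm_bound (const_mx T : 'M[BH H]_1) (fun=> x).
by rewrite -opnormE /sqn_tuple /mxapp !big_ord1 mxE.
Qed.

Lemma opnorm_le (T : BH H) (M : R) : 0 <= M ->
  (forall x, sqn (T x) <= M ^+ 2 * sqn x) -> opnorm T <= M.
Proof.
move=> M0 TM; rewrite opnormE; apply: mxopnorm_le => // x.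
by rewrite /sqn_tuple /mxapp !big_ord1 mxE.
Qed.

Lemma opnorm_eq0 (T : BH H) : opnorm T = 0 -> T = 0.
Proof.
move=> T0; apply: BH_ext => x; apply: sqn_eq0; apply/eqP.
by rewrite eq_le sqn_ge0 andbT; have := opnorm_bound T x; rewrite T0 expr0n mul0r.
Qed.

End OperatorNorm.

Lemma opnorm_contraction (R : realType) (H K : hilbertType R) (W : set (BH H)) (Y : set (BH K)) f T :
  completely_contractive W Y f -> W T -> opnorm (f T) <= opnorm T.
Proof.
move=> [_ _ fc] WT; rewrite !opnormE -(map_const_mx f).
by apply: fc => i j; rewrite mxE.
Qed.

Section MinimalProjections.
Context {R : realType} {H : hilbertType R}.
Implicit Types (V : set (BH H)) (E phi psi : BH H -> BH H).

Lemma completely_contractive_comp (K M : hilbertType R) (W : set (BH H))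
    (Y : set (BH K)) (Z : set (BH M)) f g :
  completely_contractive W Y f -> completely_contractive Y Z g ->
  completely_contractive W Z (g \o f).
Proof.
move=> [fl fY fc] [gl gZ gc]; split=> [a x y Wx Wy|x Wx|n A WA] /=.
- by rewrite fl// gl//; apply: fY.
- by apply/gZ/fY.
- rewrite map_mx_comp; apply: le_trans (fc _ _ WA); apply: gc => i j.
  by rewrite mxE; apply: fY.
Qed.

Lemma V_map_comp V phi psi : V_map V phi -> V_map V psi -> V_map V (phi \o psi).
Proof.
move=> [phic phiV] [psic psiV]; split; first exact: completely_contractive_comp psic phic.
by move=> T VT /=; rewrite psiV// phiV.
Qed.

Lemma V_map_id V : V_map V id.
Proof. by split=> //; split=> // n A _; rewrite map_mx_id. Qed.

Lemma V_map_linear V phi : V_map V phi -> forall a S T, phi (a *: S + T) = a *: phi S + phi T.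
Proof. by move=> [[phil _ _] _] a S T; apply: phil. Qed.

(** A lower bound g of a chain of V-maps is obtained from the cone of bounds that
    hold eventually along the chain; g then fixes V, where the values along the
    chain are constant, and p_g is below every p_phi, because ||psi T|| <=
    ||phi T|| for psi further along the chain than phi. *)
Lemma minimal_exists V : exists E, minimal_V_projection V E.
Proof.
pose VM := {phi | V_map V phi}.
pose le (s t : VM) := `[< forall x, V_seminorm (sval t) x <= V_seminorm (sval s) x >].
have t0 : VM by exists id; exact: V_map_id.
have [|r s t /asboolP rs /asboolP st|A Atot|E Emax] := @ZL_preorder VM t0 le.
- by move=> t; apply/asboolP.
- by apply/asboolP => x; apply: le_trans (st x) (rs x).
- have [[a Aa]|A0] := pselect (exists a, A a); last first.
    by exists t0 => s As; case: A0; exists s.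
  have lexx t : le t t by apply/asboolP.
  have letr s t u : le s t -> le t u -> le s u.
    by move=> /asboolP st /asboolP tu; apply/asboolP => x; apply: le_trans (tu x) (st x).
  have lin (t : VM) : linear_on setT (sval t) by case: (svalP t) => -[].
  pose S (u : tensor_space H H) (c : R) := exists2 t, A t &
    exists2 r, u = tens r & forall s, A s -> le t s -> Re (pairing (mapform (sval s)) r) <= c.
  have setTop := @setT_operator_space R H.
  have Scone : epigraph_cone S.
    split.
    + move=> _ _ c d [t At [r -> rc]] [t' At' [r' -> rd]].
      have [t2 At2 [tt2 tt2']] : exists2 t2, A t2 & le t t2 /\ le t' t2.
        by have [tt|tt] := Atot _ _ At At'; [exists t'|exists t].
      exists t2 => //; exists (factor_add r r'); first by rewrite tens_add.
      move=> s As t2s; rewrite (Re_pairing_add setTop)//.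
      by apply: lerD; [apply: rc|apply: rd] => //; apply: letr t2s.
    + move=> _ c k k0 [t At [r -> rc]]; exists t => //.
      exists (factor_scale (Num.sqrt k)%:C (Num.sqrt k)%:C r).
        by rewrite tens_scale_sqrt// ltW.
      move=> s As ts; rewrite (Re_pairing_scale_sqrt (ltW k0) (lin s))//.
      by rewrite ler_pM2l//; exact: rc.
    + move=> c [t At [r /(congr1 val) r0 /(_ t At (lexx t))]].
      by rewrite (pairing_zero setTop (trilinear_mapform (lin t))).
  have [r rc|g gcc gS] := map_of_cone Scone.
    exists a => //; exists r => // s As _; apply: Re_pairing_le.
    by case: (svalP s) => /(completely_contractiveP _ _ setTop)[_ _ +] _; apply.
  have gle T x y c t : A t -> (forall s, A s -> le t s -> Re (inner (sval s T x) y) <= c) ->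
      Re (inner (g T x) y) <= c.
    move=> At tc; rewrite -[inner _ _](pairing_elem (mapform g)); apply: gS.
    exists t => //; exists (factor_elem T x y) => // s As ts.
    by rewrite pairing_elem; exact: tc.
  have gV : V_map V g.
    split=> // T VT; apply: BH_le_eq => x y; apply: (gle _ _ _ _ a) => // s As _.
    by case: (svalP s) => _ ->.
  exists (exist _ g gV) => t At; apply/asboolP => T /=.
  rewrite /V_seminorm; apply: opnorm_le; first exact: opnorm_ge0.
  move=> x; set M := opnorm _.
  have := gle T x (g T x) ((M ^+ 2 * sqn x + sqn (g T x)) / 2) t At.
  rewrite -sqnE => /(_ _)-h; suff : sqn (g T x) <= (M ^+ 2 * sqn x + sqn (g T x)) / 2 by lra.
  apply: h => s As /asboolP/(_ T) ts.
  have := Re_inner_le (sval s T x) (g T x).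
  have : sqn (sval s T x) <= M ^+ 2 * sqn x.
    apply: le_trans (opnorm_bound _ _) _; rewrite ler_wpM2r ?sqn_ge0//.
    by rewrite ler_sqr ?nnegrE ?opnorm_ge0.
  by lra.
- exists (sval E); split; first exact: svalP.
  move=> phi phiV phiE; apply/funext => x; apply/eqP; rewrite eq_le phiE /=.
  by have /asboolP := Emax (exist _ phi phiV) (introT (asboolP _) phiE); apply.
Qed.

Lemma sqn_convex (t : R) (x y : H) : 0 <= t <= 1 ->
  sqn (t%:C *: x + (1 - t)%:C *: y) <= t * sqn x + (1 - t) * sqn y.
Proof.
move=> /andP[t0 t1]; rewrite sqnD !sqnZr innerZl innerZr.
have -> : ((1 - t)%:C)^*%R = (1 - t)%:C by exact: conjc_real.
rewrite !Re_realM.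
have := Re_inner_le x y; have := mulr_ge0 t0 (_ : 0 <= 1 - t).
by rewrite subr_ge0 => /(_ t1); nra.
Qed.

(** Contractivity of a convex combination follows from the convexity of the
    squared norm. *)
Lemma V_map_convex V phi psi (t : R) : 0 <= t <= 1 -> V_map V phi -> V_map V psi ->
  V_map V (fun T => t%:C *: phi T + (1 - t)%:C *: psi T).
Proof.
move=> t01 Vphi Vpsi; split; last first.
  move=> T VT; rewrite Vphi.2// Vpsi.2// -scalerDl -rmorphD.
  by rewrite addrC subrK scale1r.
have setTop := @setT_operator_space R H.
have /(completely_contractiveP _ _ setTop)[_ _ phic] := Vphi.1.
have /(completely_contractiveP _ _ setTop)[_ _ psic] := Vpsi.1.
apply/(completely_contractiveP _ _ setTop); split=> //.
  move=> a S T _ _; rewrite (V_map_linear Vphi) (V_map_linear Vpsi).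
  by rewrite !scalerDr !scalerA addrACA ![a * _]mulrC.
move=> n A _ Ac x; set B := map_mx _ A.
have BE i : mxapp B x i = t%:C *: mxapp (map_mx phi A) x i +
    (1 - t)%:C *: mxapp (map_mx psi A) x i.
  rewrite /mxapp !scaler_sumr -big_split; apply: eq_bigr => j _ /=.
  by rewrite !mxE addBHE !scaleBHE.
apply: (@le_trans _ _ (t * sqn_tuple (mxapp (map_mx phi A) x) +
    (1 - t) * sqn_tuple (mxapp (map_mx psi A) x))).
  rewrite /sqn_tuple !mulr_sumr -big_split; apply: ler_sum => i _.
  by rewrite BE; exact: sqn_convex.
case/andP: t01 => t0 t1.
have h1 := ler_wpM2l t0 (phic n A (fun _ _ => I) Ac x).
have t10 : 0 <= 1 - t by rewrite subr_ge0.
have := ler_wpM2l t10 (psic n A (fun _ _ => I) Ac x).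
by lra.
Qed.

Lemma opnorm_convex (t M : R) (S T : BH H) : 0 <= t <= 1 ->
  opnorm S <= M -> opnorm T <= M -> opnorm (t%:C *: S + (1 - t)%:C *: T) <= M.
Proof.
move=> t01 SM TM; have M0 := le_trans (opnorm_ge0 S) SM.
apply: opnorm_le => // x; rewrite addBHE !scaleBHE.
apply: le_trans (sqn_convex _ _ t01) _; case/andP: t01 => t0 t1.
have bd (U : BH H) : opnorm U <= M -> sqn (U x) <= M ^+ 2 * sqn x.
  move=> UM; apply: le_trans (opnorm_bound U x) _; rewrite ler_wpM2r ?sqn_ge0//.
  by rewrite ler_sqr ?nnegrE ?opnorm_ge0.
have t10 : 0 <= 1 - t by rewrite subr_ge0.
have := ler_wpM2l t0 (bd S SM); have := ler_wpM2l t10 (bd T TM); lra.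
Qed.

Lemma V_map_iter V E n : V_map V E -> V_map V (iter n E).
Proof.
by move=> EV; elim: n => [|n IH]; [exact: V_map_id|exact: V_map_comp EV IH].
Qed.

Lemma opnorm_V_map V phi T : V_map V phi -> opnorm (phi T) <= opnorm T.
Proof. by move=> [phic _]; apply: opnorm_contraction phic _. Qed.

(** The map phi is the average of E, ..., E^(n+1), built as an iterated convex
    combination of V-maps; the right-hand side is a telescoping sum. *)
Lemma minimal_average V E n T : V_map V E -> exists phi,
  [/\ V_map V phi, forall x, V_seminorm phi x <= V_seminorm E x &
      n.+1%:R *: phi (T - E T) = E T - iter n.+2 E T].
Proof.
move=> EV.
have NE phi : V_map V phi -> forall S U, phi (S - U) = phi S - phi U.
  by move=> phiV S U; rewrite addrC -scaleN1r (V_map_linear phiV) scaleN1r addrC.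
elim: n => [|n [phi [phiV phiE phin]]].
  by exists E; split=> //; rewrite scale1r (NE _ EV).
pose t : R := n.+1%:R / n.+2%:R.
have n2 : (n.+2%:R : R) != 0 by rewrite pnatr_eq0.
have t01 : 0 <= t <= 1.
  by rewrite divr_ge0//= ler_pdivrMr ?ltr0n// mul1r ler_nat.
have EnV := V_map_iter n.+2 EV.
exists (fun x => t%:C *: phi x + (1 - t)%:C *: iter n.+2 E x); split.
- exact: V_map_convex.
- move=> x; apply: opnorm_convex => //; first exact: phiE.
  by rewrite iterSr; apply: opnorm_V_map; exact: V_map_iter EV.
- have -> : (n.+2%:R : R[i]) = (n.+2%:R)%:C by rewrite rmorph_nat.
  rewrite scalerDr !scalerA -!rmorphM.
  have -> : n.+2%:R * t = n.+1%:R :> R by rewrite /t mulrC divfK.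
  have -> : n.+2%:R * (1 - t) = 1 :> R.
    by rewrite mulrBr mulr1 /t mulrC divfK// -natrB// subSn// subnn.
  rewrite rmorph_nat phin scale1r (NE _ EnV) addrA subrK.
  by rewrite -iterSr.
Qed.

(** By minimality the averages have the seminorm of E, so that E (T - E T) has
    the norm of (E T - E^(n+2) T) / (n+1), at most 2 ||T|| / (n+1). *)
Lemma minimal_idempotent V E : minimal_V_projection V E -> forall T, E (E T) = E T.
Proof.
move=> [EV Emin] T; apply/eqP; rewrite eq_sym -subr_eq0; apply/eqP/opnorm_eq0.
have -> : E T - E (E T) = E (T - E T).
  have := V_map_linear EV (-1) (E T) T; rewrite !scaleN1r => EN.
  by rewrite [T - _]addrC EN addrC.
apply/eqP; rewrite eq_le opnorm_ge0 andbT.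
apply/ler_addgt0Pl => e e0; rewrite addr0.
pose M := opnorm T.
pose n := Num.bound (2 * M / e).
have nM : 2 * M < n.+1%:R * e.
  rewrite -ltr_pdivrMr//; apply: lt_trans (archi_boundP _) _.
    by rewrite divr_ge0 ?mulr_ge0 ?opnorm_ge0 ?ltW.
  by rewrite ltr_nat.
have [phi [phiV phiE phin]] := minimal_average n T EV.
have -> : opnorm (E (T - E T)) = opnorm (phi (T - E T)).
  by have /(congr1 (fun p => p (T - E T))) := Emin phi phiV phiE.
apply: opnorm_le; first exact: ltW.
move=> x; have := congr1 (fun U : BH H => sqn (U x)) phin.
rewrite addBHE oppBHE scaleBHE -(rmorph_nat (real_complex R)) sqnZr => phix.
have k0 : 0 < (n.+1%:R : R) ^+ 2 by rewrite exprn_gt0// ltr0n.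
rewrite -(ler_pM2l k0) phix.
have b1 : sqn (E T x) <= M ^+ 2 * sqn x.
  apply: le_trans (opnorm_bound _ _) _; rewrite ler_wpM2r ?sqn_ge0//.
  by rewrite ler_sqr ?nnegrE ?opnorm_ge0//; exact: opnorm_V_map EV.
have b2 : sqn (iter n.+2 E T x) <= M ^+ 2 * sqn x.
  apply: le_trans (opnorm_bound _ _) _; rewrite ler_wpM2r ?sqn_ge0//.
  by rewrite ler_sqr ?nnegrE ?opnorm_ge0//; exact: opnorm_V_map (V_map_iter _ EV).
have := Re_inner_le (E T x) (- iter n.+2 E T x); rewrite sqnD sqnN => b3.
have b4 : (2 * M) ^+ 2 * sqn x <= (n.+1%:R * e) ^+ 2 * sqn x.
  rewrite ler_wpM2r ?sqn_ge0// ler_sqr ?nnegrE ?mulr_ge0 ?opnorm_ge0//; exact: ltW.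
move: b4; rewrite !exprMn; lra.
Qed.

End MinimalProjections.

(** * Extensions of inverses, and rigidity *)
Section Weakening.
Context {R : realType} {H K : hilbertType R}.
Implicit Types (W : set (BH H)) (Y : set (BH K)).

Lemma completely_contractive_weaken W W' Y Y' (f : BH H -> BH K) :
  W' `<=` W -> Y `<=` Y' ->
  completely_contractive W Y f -> completely_contractive W' Y' f.
Proof.
move=> W'W YY' [fl fY fc]; split=> [a x y /W'W Wx /W'W Wy|x /W'W Wx|n A WA].
- exact: fl.
- exact/YY'/fY.
- by apply: fc => i j; apply/W'W/WA.
Qed.

Lemma completely_isometric_contractive W Y (f : BH H -> BH K) :
  completely_isometric W Y f -> completely_contractive W Y f.
Proof. by move=> [fl fY fi]; split=> // n A /fi ->. Qed.

(** The inverse of j is a complete isometry from j(W) into B(H), to which the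
    extension theorem applies. *)
Lemma inverse_extension W Y (j : BH H -> BH K) : operator_space W ->
  completely_isometric W Y j ->
  exists2 psi : BH K -> BH H, completely_contractive setT setT psi &
    forall x, W x -> psi (j x) = x.
Proof.
move=> Wop [jl jY ji]; have [W0 Wlin] := Wop.
have j_inj x y : W x -> W y -> j x = j y -> x = y.
  move=> Wx Wy jxy; apply/eqP; rewrite -subr_eq0; apply/eqP/opnorm_eq0.
  have Wxy : W (x - y) by rewrite addrC -scaleN1r; exact: Wlin.
  have j0 : j (x - y) = 0 by rewrite addrC -scaleN1r jl// jxy scaleN1r addNr.
  rewrite opnormE -ji; last by move=> ? ?; rewrite mxE.
  rewrite map_const_mx j0 -opnormE; apply/eqP; rewrite eq_le opnorm_ge0 andbT.
  by apply: opnorm_le => // z; rewrite BH0E sqn0 expr0n mul0r.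
pose f T := xget 0 [set x | W x /\ j x = T].
have fP T : (j @` W) T -> W (f T) /\ j (f T) = T.
  by move=> [x Wx jx]; rewrite /f; case: xgetP => [y _ //|/(_ x)[]].
have jW_op : operator_space (j @` W).
  split; first by exists 0 => //; have := jl (-1) 0 0 W0 W0; rewrite scaler0 addr0 scaleN1r addNr.
  move=> a _ _ [x Wx <-] [y Wy <-]; exists (a *: x + y); first exact: Wlin.
  exact: jl.
have fcc : completely_contractive (j @` W) setT f.
  split=> // [a S T jS jT|n A jA].
    have [[WS SE] [WT TE]] := (fP S jS, fP T jT).
    have [|WST STE] := fP (a *: S + T); first exact: jW_op.2.
    by apply: j_inj => //; [exact: Wlin|rewrite STE jl// SE TE].
  rewrite -ji => [|i i']; last by rewrite mxE; exact: (fP _ (jA i i')).1.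
  rewrite -map_mx_comp (_ : map_mx (j \o f) A = A)//.
  by apply/matrixP => i i'; rewrite mxE /=; exact: (fP _ (jA i i')).2.
have [psi psic psif] := wittstock_extension jW_op fcc; exists psi => // x Wx.
have jx : (j @` W) (j x) by exists x.
rewrite psif ?inE//; have [Wf jf] := fP _ jx; exact: j_inj.
Qed.

Lemma injective_projection Y : injective_space Y ->
  exists2 Q : BH K -> BH K, completely_contractive setT Y Q &
    forall y, Y y -> Q y = y.
Proof.
move=> [Yop Yinj]; have [|Q Qc QE] := Yinj K Y setT Yop (@setT_operator_space R K) (fun _ _ => I) id.
  by split=> // n A _; rewrite map_mx_id.
by exists Q => // y Yy; rewrite QE// inE.
Qed.

End Weakening.

Section Minimality.
Context {R : realType} {H : hilbertType R}.
Implicit Types (V : set (BH H)) (E phi : BH H -> BH H).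

Lemma minimal_of_le V E phi : minimal_V_projection V E -> V_map V phi ->
  (forall x, V_seminorm phi x <= V_seminorm E x) ->
  minimal_V_projection V phi /\ V_seminorm phi = V_seminorm E.
Proof.
move=> [EV Emin] phiV phiE; have phiEE := Emin phi phiV phiE.
split=> //; split=> // psi psiV psiphi.
by rewrite phiEE; apply: Emin => // x; rewrite -phiEE.
Qed.

Lemma minimal_comp V E phi : minimal_V_projection V E -> V_map V phi ->
  minimal_V_projection V (phi \o E).
Proof.
move=> Emin phiV.
by have [] := minimal_of_le Emin (V_map_comp phiV Emin.1)
  (fun x => opnorm_V_map (E x) phiV).
Qed.

(** Extensions into Y are pushed into the range of P by composing with P. *)
Lemma range_injective V P Y : V_map V P -> completely_contractive setT Y P ->
  (forall x, P (P x) = P x) -> injective_space Y -> injective_space (range P).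
Proof.
move=> PV Pc PP [Yop Yinj]; have Pl := V_map_linear PV; split.
  split; first by exists 0 => //; have := Pl (-1) 0 0; rewrite scaler0 addr0 scaleN1r addNr.
  by move=> a _ _ [x _ <-] [y _ <-]; exists (a *: x + y); rewrite ?Pl.
move=> L W Z Wop Zop WZ f fc.
have PY : range P `<=` Y by move=> _ [x _ <-]; case: Pc => _ + _; apply.
have [|g gc gf] := Yinj L W Z Wop Zop WZ f.
  exact: completely_contractive_weaken fc.
exists (P \o g).
  apply: completely_contractive_comp gc _.
  case: PV => -[Pl' _ Pn] _; split=> [a x y _ _|x _|n A _]; first exact: Pl.
    by exists x.
  exact: Pn.
move=> x Wx /=; rewrite gf//; rewrite inE in Wx.
by case: fc => _ /(_ x Wx)[y _ <-] _; rewrite PP.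
Qed.

(** Compose a minimal U-projection with a projection onto Y: the result P is
    minimal with injective range between U and Y, so its range is Y.  Then
    theta o P is minimal too, hence idempotent and with the seminorm of P, so
    theta is an idempotent isometry of Y. *)
Lemma rigidity (U Y : set (BH H)) theta : injective_space Y -> U `<=` Y ->
  (forall Z, injective_space Z -> U `<=` Z -> Z `<=` Y -> Z = Y) ->
  completely_contractive Y Y theta -> (forall u, U u -> theta u = u) ->
  forall y, Y y -> theta y = y.
Proof.
move=> Yinj UY Ymin thc thU.
have [Q Qc QE] := injective_projection Yinj.
have [E Emin] := minimal_exists U.
have QU : V_map U Q.
  split; first exact: completely_contractive_weaken Qc.
  by move=> u; rewrite inE => /UY; exact: QE.
pose P := Q \o E; have Pmin : minimal_V_projection U P by exact: minimal_comp.
have Pc : completely_contractive setT Y P.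
  exact: completely_contractive_comp Emin.1.1 Qc.
have PP := minimal_idempotent Pmin.
have PY : range P = Y.
  apply: Ymin.
  - exact: range_injective Pmin.1 Pc PP Yinj.
  - by move=> u Uu; exists u => //; apply: Pmin.1.2; rewrite inE.
  - by move=> _ [x _ <-]; case: Pc => _ + _; apply.
have PE y : Y y -> P y = y by rewrite -PY => -[x _ <-]; exact: PP.
have thPc : completely_contractive setT Y (theta \o P).
  exact: completely_contractive_comp Pc thc.
have thPU : V_map U (theta \o P).
  split; first exact: completely_contractive_weaken thPc.
  by move=> u; rewrite inE => Uu /=; rewrite PE ?thU//; exact: UY.
have PYx x : Y (P x) by rewrite -PY; exists x.
have [thPmin thPn] := minimal_of_le Pmin thPU (fun x => opnorm_contraction thc (PYx x)).
move=> y Yy; have [thl thY _] := thc.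
have Yth := thY y Yy.
have thth : theta (theta y) = theta y.
  by have := minimal_idempotent thPmin y; rewrite /= (PE y)// (PE _ Yth).
have Yd : Y (theta y - y) by rewrite addrC -scaleN1r; exact: Yinj.1.2.
apply/eqP; rewrite -subr_eq0; apply/eqP/opnorm_eq0.
have := congr1 (fun p => p (theta y - y)) thPn.
rewrite /V_seminorm /= PE// => <-.
rewrite addrC -scaleN1r thl// thth scaleN1r addNr.
apply/eqP; rewrite eq_le opnorm_ge0 andbT.
by apply: opnorm_le => // z; rewrite BH0E sqn0 expr0n mul0r.
Qed.

End Minimality.

(** * The fixed space and its envelopes *)
Section FixedSpaceProperties.
Context {R : realType} {H : hilbertType R}.
Implicit Types (V : set (BH H)).

Lemma sub_fixed_space V : V `<=` fixed_space V.
Proof. by move=> T VT phi [_ ->]//; rewrite inE. Qed.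

Lemma fixed_space_operator V : operator_space (fixed_space V).
Proof.
split=> [phi /V_map_linear phil|a S T FS FT phi phiV].
  by have := phil (-1) 0 0; rewrite scaler0 addr0 scaleN1r addNr.
by rewrite (V_map_linear phiV) FS// FT.
Qed.

Lemma V_map_fixed_space V : V_map (fixed_space V) = V_map V.
Proof.
apply/funext => phi; apply/propext; split=> -[phic phiE]; split=> // T.
  rewrite inE => VT; apply: phiE; rewrite inE; exact: sub_fixed_space.
by rewrite inE; apply.
Qed.

(** If E is minimal then so is phi o E, and T is fixed by both. *)
Lemma fixed_by_minimal V T :
  (forall E, minimal_V_projection V E -> E T = T) -> fixed_space V T.
Proof.
move=> ET phi phiV; have [E Emin] := minimal_exists V.
have := ET _ (minimal_comp Emin phiV).
by rewrite /= (ET E).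
Qed.

(** The extension k of j to B(H) is completely isometric on the fixed space: if
    psi extends the inverse of j, then psi o k is a V-map, and so fixes that
    space pointwise. *)
Lemma envelope_of_fixed_space V (K : hilbertType R) (Y : set (BH K)) j :
  operator_space V -> injective_envelope V Y j ->
  exists2 k, injective_envelope (fixed_space V) Y k & {in V, k =1 j}.
Proof.
move=> Vop [[Yop Yinj] ji Ymin].
have [|k kc kj] := Yinj H V setT Vop (@setT_operator_space R H) (fun _ _ => I) j.
  exact: completely_isometric_contractive ji.
have [psi psic psij] := inverse_extension Vop ji.
have psik : V_map V (psi \o k).
  split; first apply: completely_contractive_comp psic.
    exact: completely_contractive_weaken kc.
  by move=> x Vx /=; rewrite kj//; apply: psij; rewrite inE in Vx.
exists k => //; split=> //.
  have [kl kY kn] := kc; split=> [a x y _ _|x _|n A FA].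
  - exact: kl.
  - exact: kY.
  - apply/eqP; rewrite eq_le kn//=.
    have AE : map_mx psi (map_mx k A) = A.
      by rewrite -map_mx_comp; apply/matrixP => i i'; rewrite mxE; exact: FA.
    by rewrite -[in leLHS]AE; case: psic => _ _; apply.
move=> Z Zinj kZ ZY; apply: Ymin => // _ [x Vx <-].
by rewrite -kj ?inE//; apply: kZ; exists x => //; exact: sub_fixed_space.
Qed.

(** Let Z be injective between k(V) and Y, P a projection onto Z, l an extension
    of k to B(H) and psi an extension of the inverse of k.  Then psi o P o l is a
    V-map, so it fixes the fixed space, and l o psi o P fixes its image in Y.  By
    rigidity l o psi o P is the identity on Y; as it factors through P, which is
    idempotent with range Z, the space Y is Z. *)
Lemma envelope_from_fixed_space V (K : hilbertType R) (Y : set (BH K)) k :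
  injective_envelope (fixed_space V) Y k -> injective_envelope V Y k.
Proof.
set F := fixed_space V => -[Yinj [kl kY kn] Ymin].
have Fop : operator_space F := fixed_space_operator V.
split=> //.
  split=> [a x y /sub_fixed_space Fx /sub_fixed_space Fy|x /sub_fixed_space|n A VA].
  - exact: kl.
  - exact: kY.
  - by apply: kn => i j; apply/sub_fixed_space/VA.
move=> Z Zinj kZ ZY; apply/seteqP; split=> // y Yy.
have ki : completely_isometric F Y k by split.
have [|l lc lk] := Yinj.2 H F setT Fop (@setT_operator_space R H) (fun _ _ => I) k.
  exact: completely_isometric_contractive ki.
have [psi psic psik] := inverse_extension Fop ki.
have [P Pc PE] := injective_projection Zinj.
have psiPc : completely_contractive setT setT (psi \o P).
  apply: completely_contractive_comp psic.
  exact: completely_contractive_weaken Pc.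
have psiPl : V_map V (psi \o P \o l).
  split.
    apply: completely_contractive_comp psiPc.
    exact: completely_contractive_weaken lc.
  move=> v; rewrite inE => Vv; have Fv := sub_fixed_space Vv.
  by rewrite /= lk ?inE// PE ?psik//; apply: kZ; exists v.
have thk u : (k @` F) u -> (l \o (psi \o P)) u = u.
  by move=> [w Fw <-]; have := Fw _ psiPl; rewrite /= lk ?inE// => ->; rewrite lk ?inE.
have thE z : Y z -> (l \o (psi \o P)) z = z.
  apply: (rigidity Yinj _ Ymin _ thk); first by move=> _ [w Fw <-]; exact: kY.
  exact: completely_contractive_weaken (completely_contractive_comp psiPc lc).
have ZP x : Z (P x) by case: Pc => _ + _; apply.
have := thE y Yy; rewrite /= -(PE _ (ZP y)) => yE.
by rewrite -yE -[l _]/((l \o (psi \o P)) (P y)) thE//; exact: ZY.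
Qed.

End FixedSpaceProperties.

Theorem proposition4p3 (R : realType) (H : hilbertType R) (V : set (BH H)) :
  operator_space V ->
  [/\ fixed_space V =
        [set T | forall E : BH H -> BH H, minimal_V_projection V E -> E T = T],
      fixed_space V = \bigcap_(S in envelope_copy V) S &
      same_injective_envelope V (fixed_space V)].
Proof.
move=> Vop; split.
- apply/seteqP; split=> T /=; last exact: fixed_by_minimal.
  by move=> FT E [EV _]; exact: FT.
- apply/seteqP; split=> T.
    by move=> FT _ [E [EV _] ->]; exists T => //; exact: FT.
  move=> ST; apply: fixed_by_minimal => E Emin.
  have [|x _ <-] := ST (range E); first by exists E.
  exact: minimal_idempotent Emin x.
- split=> [S|K Y j|K Y k].
  + by rewrite /envelope_copy /minimal_V_projection V_map_fixed_space.
  + exact: envelope_of_fixed_space.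
  + exact: envelope_from_fixed_space.
Qed.
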